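(* Let $V\in\mathbb{R}$, $E\in\mathbb{R}$ and $F\in(-\infty,\infty]$. Let $D_X:=\mathbb{E}X-\exp\mathbb{E}\ln X$ for $X\in\mathcal{X}_+$. Then $$\sup\{D_X\colon X\in\mathcal{X}_{\sup;V,E}\}=\max(2V,E)\quad\text{if }\mathcal{X}_{\sup;V,E}\neq\emptyset,$$ $$\inf\{D_X\colon X\in\mathcal{X}_{\inf;V,F}\}=\min(2V,E_{V,F})\quad\text{if }\mathcal{X}_{\inf;V,F}\neq\emptyset.$$ These equalities hold if the sets $\mathcal{X}_{\sup;V,E}$ and $\mathcal{X}_{\inf;V,F}$ are replaced there by their respective subsets consisting of the random variables in $\mathcal{X}_{\sup;V,E}$ and $\mathcal{X}_{\inf;V,F}$ taking at most two values.
   Context: $\mathcal{X}_+$ denotes the set of all nonnegative random variables $X$ with $\mathbb{E}X<\infty$. Conventions: $\ln 0:=-\infty$ and $\exp(-\infty):=0$; it is possible that $\mathbb{E}\ln X=-\infty$. For $X\in\mathcal{X}_+$, let $\operatorname{supp}X$ be the support of the distribution of $X$, $m_X:=\inf\operatorname{supp}X\in[0,\infty)$, $M_X:=\sup\operatorname{supp}X\in[m_X,\infty]$, and $$V_X:=\operatorname{Var}\sqrt X,\quad E_X:=\mathbb{E}\big(\sqrt X-\sqrt{m_X}\big)^2,\quad F_X:=\mathbb{E}\big(\sqrt{M_X}-\sqrt X\big)^2,$$ with $F_X=\infty$ if $M_X=\infty$. For $V,E\in\mathbb{R}$ and $F\in(-\infty,\infty]$, let $$\mathcal{X}_{\sup;V,E}:=\{X\in\mathcal{X}_+\colon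 V_X=V,\ E_X=E\},\qquad \mathcal{X}_{\inf;V,F}:=\{X\in\mathcal{X}_+\colon V_X=V,\ F_X=F\},$$ $$E_{V,F}:=\frac{FV}{F-V},$$ with the conventions that $\frac{FV}{F-V}$ equals $V$ if $F=\infty$ and equals $0$ if $F=V$. *)

(* Defs.v *)
From HB Require Import structures.
From mathcomp Require Import all_boot all_order all_algebra.
From mathcomp Require Import all_classical all_reals all_analysis.

Set Implicit Arguments.
Unset Strict Implicit.
Unset Printing Implicit Defensive.

Import Order.TTheory GRing.Theory Num.Theory.
Import numFieldNormedType.Exports.

Local Open Scope classical_set_scope.
Local Open Scope ring_scope.

(* No probability space is fixed in advance: an element of rvar R is a random
   variable together with the probability space on which it is defined. *)
Record rvar (R : realType) := Rvar {
  rv_display : measure_display;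
  rv_space : measurableType rv_display;
  rv_prob : probability rv_space R;
  rv_fun : {RV rv_prob >-> R} }.

Section rvar_functionals.
Context {R : realType}.
Implicit Types X : rvar R.
Local Open Scope ereal_scope.

(* Classes of random variables are plain predicates rvar R -> Prop: rvar R is
   too large a type (it quantifies over sample spaces) for set (rvar R). *)
Definition Xplus X : Prop :=
  (forall w, (0 <= rv_fun X w)%R) /\ 'E_(rv_prob X)[rv_fun X] < +oo.

Definition supp X : set R :=
  [set x | forall U : set R, open U -> U x ->
           0 < distribution (rv_prob X) (rv_fun X) U].

Definition mX X : R := inf (supp X).

Definition MX X : \bar R := ereal_sup (EFin @` supp X).

Definition VX X : \bar R :=
  'V_(rv_prob X)[fun w => Num.sqrt (rv_fun X w)].

Definition EX X : \bar R :=
  'E_(rv_prob X)[fun w =>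
    ((Num.sqrt (rv_fun X w) - Num.sqrt (mX X)) ^+ 2)%R].

(* The -oo branch is never taken on Xplus, where the support is nonempty. *)
Definition FX X : \bar R :=
  match MX X with
  | M%:E => 'E_(rv_prob X)[fun w =>
              ((Num.sqrt M - Num.sqrt (rv_fun X w)) ^+ 2)%R]
  | _ => +oo
  end.

(* lne 0 = -oo and expeR -oo = 0, so E ln X = -oo is allowed. *)
Definition DX X : \bar R :=
  'E_(rv_prob X)[rv_fun X]
  - expeR (\int[rv_prob X]_w lne (rv_fun X w)%:E).

Definition DX_image (A : rvar R -> Prop) : set (\bar R) :=
  [set y | exists2 X, A X & DX X = y].

Definition Xsup (V E : R) X : Prop :=
  [/\ Xplus X, VX X = V%:E & EX X = E%:E].

Definition Xinf (V : R) (F : \bar R) X : Prop :=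
  [/\ Xplus X, VX X = V%:E & FX X = F].

Definition at_most_two_values X : Prop :=
  exists a b : R, range (rv_fun X) `<=` [set a; b].

Definition Xsup2 (V E : R) X : Prop := Xsup V E X /\ at_most_two_values X.

Definition Xinf2 (V : R) (F : \bar R) X : Prop :=
  Xinf V F X /\ at_most_two_values X.

(* Only meant for -oo < F; the value at F = -oo is irrelevant. *)
Definition EVF (V : R) (F : \bar R) : R :=
  match F with
  | F'%:E => if F' == V then 0%R else (F' * V / (F' - V))%R
  | _ => V
  end.

End rvar_functionals.

(* Main.v *)
Require Import Defs.
From HB Require Import structures.
From mathcomp Require Import all_boot all_order all_algebra.
From mathcomp Require Import all_classical all_reals all_analysis.
From mathcomp Require Import unstable measurable_realfun.
From mathcomp Require Import ring lra.
Import Order.TTheory GRing.Theory Num.Theory.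
Import numFieldNormedType.Exports.
Local Open Scope classical_set_scope.
Local Open Scope ring_scope.

(* Put Y = sqrt X, so that D = E Y^2 - exp (2 E ln Y). Since ln has a positive
   third derivative, for Y >= m the quadratic q with q(m) = ln m that is tangent
   to ln at some b > m lies below ln on [m, +oo[, and E q(Y) depends only on the
   first two moments of Y. Choosing b so that some law on {m, b} has these
   moments, E ln Y is at least its value for the two-point law, and
   symmetrically E ln Y is at most its value for a law on {a, M} when Y <= M.
   This leaves the comparison of (b / m)^(2p) with its Taylor polynomials of
   order one and two. Both bounds are reached along two-point laws of Y: when
   the smaller value is 0 (D is then E_X, resp. E_{V,F}), and as both values
   tend to infinity with a fixed gap (D then tends to 2V). When F = +oo, the
   bound V is Jensen's inequality, and it is approached by mixing the law of a
   multiple of X with an atom at 0 whose mass tends to 1. *)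

(** * Calculus: Taylor bounds for the logarithm and for powers *)

Section real_analysis.
Context {R : realType}.
Implicit Types (a b x y z s p : R).

Lemma is_derive_ge0_le (f f' : R -> R) a b : a <= b ->
  (forall x, a <= x <= b -> is_derive x 1 f (f' x)) ->
  (forall x, a <= x <= b -> 0 <= f' x) -> f a <= f b.
Proof.
move=> ab df f'0.
have sub x : x \in `]a, b[ -> a <= x <= b.
  by rewrite in_itv/= => /andP[ax xb]; rewrite !ltW.
apply: (@ger0_derive1_le_cc R f a b) => //.
- by move=> x /sub /df [].
- by move=> x /sub xab; rewrite derive1E; have [_ ->] := df _ xab; exact: f'0.
- apply: derivable_within_continuous => x; rewrite in_itv/= => /df.
  by case.
- by rewrite in_itv/= lexx.
- by rewrite in_itv/= lexx ab.
Qed.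

Lemma is_derive_inv (f : R -> R) (df : R) x : f x != 0 ->
  is_derive x 1 f df -> is_derive x 1 (fun t => (f t)^-1) (- (f x) ^- 2 * df).
Proof.
move=> fx0 [dfx <-]; apply: DeriveDef; first exact: derivableV.
by rewrite deriveV.
Qed.

(** One cubic centred at 1 serves for the Taylor polynomials of orders one to three; passing through
    [{poly R}] lets its derivative be computed by rewriting. *)
Lemma is_derive_cubic (a0 a1 a2 a3 t : R) :
  is_derive t 1
    (fun u => a0 + a1 * (u - 1) + a2 * (u - 1) ^+ 2 + a3 * (u - 1) ^+ 3)
    (a1 + 2 * a2 * (t - 1) + 3 * a3 * (t - 1) ^+ 2).
Proof.
pose P : {poly R} := a0%:P + a1 *: ('X - 1%:P) + a2 *: ('X - 1%:P) ^+ 2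
  + a3 *: ('X - 1%:P) ^+ 3.
rewrite (_ : (fun _ => _) = horner P); last first.
  by apply/funext => u; rewrite !hornerE.
apply: (is_derive_eq (is_derive_poly P t)).
rewrite /P !(derivD, derivZ, derivC, derivN, derivX, deriv_exp) !hornerE/=.
by ring.
Qed.

(** The derivative is [(z - 1) ^+ 2 / z]. As the function vanishes at 1, its sign compares the
    quotient of [ln_quotient_le] with -1/2 on either side of 1. *)
Lemma ln_taylor2_le x y : 0 < x -> x <= y ->
  ln x - x + 1 + (x - 1) ^+ 2 / 2 <= ln y - y + 1 + (y - 1) ^+ 2 / 2.
Proof.
move=> x0 xy.
apply: (@is_derive_ge0_le (fun z => ln z - z + 1 + (z - 1) ^+ 2 / 2)
  (fun z => (z - 1) ^+ 2 / z)) => // z /andP[xz _].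
  have z0 : 0 < z by exact: lt_le_trans xz.
  have := is_deriveD (is_derive1_ln z0) (is_derive_cubic 0 (- 1) 2^-1 0 z).
  congr is_derive; last by field; exact: lt0r_neq0.
  by apply/funext => u; rewrite fctE; field.
by rewrite divr_ge0 ?sqr_ge0// ltW// (lt_le_trans x0).
Qed.

(** This function is a factor of the derivative of the quotient treated in [ln_quotient_le]. It
    increases and vanishes at 1, so it has the sign of z - 1. *)
Lemma ln_half_sub_inv_le x y : 0 < x -> x <= y ->
  x - x^-1 - 2 * ln x <= y - y^-1 - 2 * ln y.
Proof.
move=> x0 xy.
apply: (@is_derive_ge0_le (fun z => z - z^-1 - 2 * ln z)
  (fun z => (1 - z^-1) ^+ 2)) => // [z /andP[xz _]|z _].
  have z0 : 0 < z by exact: lt_le_trans xz.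
  have zn0 : z != 0 by exact: lt0r_neq0.
  rewrite (_ : (fun _ => _) =
    (id : R -> R) - (fun t => t^-1) - 2 *: @ln R); last first.
    by apply/funext => t; rewrite ?fctE.
  have dV := is_derive_inv id _ z zn0 (is_derive_id z 1).
  have dln := is_derive1_ln z0.
  apply: is_derive_eq; rewrite /GRing.scale/= ?fctE/=; field.
  by [].
exact: sqr_ge0.
Qed.

(* Monotonicity of (ln z - z + 1) / (z - 1)^2, cross-multiplied to include
   z = 1. *)
Lemma ln_quotient_le x y : 0 < x -> x <= y ->
  (ln x - x + 1) * (y - 1) ^+ 2 <= (ln y - y + 1) * (x - 1) ^+ 2.
Proof.
move=> x0 xy; have y0 := lt_le_trans x0 xy.
have sub_le1 z : 0 < z -> z <= 1 -> ln z - z + 1 + (z - 1) ^+ 2 / 2 <= 0.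
  by move=> z0 /(ln_taylor2_le _ _ z0); rewrite ln1 !subrr expr0n/= mul0r; lra.
have sub_ge1 z : 1 <= z -> 0 <= ln z - z + 1 + (z - 1) ^+ 2 / 2.
  by move=> /(ln_taylor2_le _ _ ltr01); rewrite ln1 !subrr expr0n/= mul0r; lra.
(* If x <= 1 <= y, the value -1/2 separates the two quotients. There remain intervals that avoid 1,
   where the quotient can be differentiated. *)
suff same_side : (y < 1) || (1 < x) -> (ln x - x + 1) * (y - 1) ^+ 2 <=
    (ln y - y + 1) * (x - 1) ^+ 2.
  have [x1|x1] := leP x 1; last by rewrite same_side// x1 orbT.
  have [y1|y1] := ltP y 1; first by rewrite same_side// y1.
  have := sub_le1 _ x0 x1; have := sub_ge1 _ y1.
  have := sqr_ge0 (x - 1); have := sqr_ge0 (y - 1).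
  by set u := _ ^+ 2; set v := (x - 1) ^+ 2; nra.
move=> xy1.
have n1 z : x <= z <= y -> z - 1 != 0.
  move=> /andP[xz zy]; rewrite subr_eq0; apply/eqP => z1.
  by case/orP: xy1; lra.
have sq0 z : x <= z <= y -> 0 < (z - 1) ^+ 2.
  by move=> /n1 zn1; rewrite lt_neqAle eq_sym expf_neq0//= sqr_ge0.
rewrite -ler_pdivrMr ?sq0 ?xy ?lexx// mulrAC -ler_pdivlMr ?sq0 ?xy ?lexx//.
apply: (@is_derive_ge0_le (fun z => (ln z - z + 1) / (z - 1) ^+ 2)
  (fun z => (z - 1) * (z - z^-1 - 2 * ln z) / ((z - 1) ^+ 2) ^+ 2)) => // z xzy.
  have z0 : 0 < z by case/andP: xzy => xz _; exact: lt_le_trans xz.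
  have z10 : (z - 1) ^+ 2 != 0 by rewrite expf_neq0// n1.
  rewrite (_ : (fun _ => _) =
    (@ln R - id + cst 1) * (fun t => ((t - 1) ^+ 2)^-1)); last first.
    by apply/funext => t; rewrite ?fctE.
  have dsq : is_derive z 1 (fun t => (t - 1) ^+ 2) (2 * (z - 1)).
    rewrite (_ : (fun _ => _) = (id - cst 1) ^+ 2)//.
    by apply: is_derive_eq; rewrite /GRing.scale/= ?fctE/=; ring.
  have dV := is_derive_inv (fun t => (t - 1) ^+ 2) _ z z10 dsq.
  have dln := is_derive1_ln z0.
  apply: is_derive_eq; rewrite /GRing.scale/= ?fctE/=; field.
  by rewrite n1// lt0r_neq0.
rewrite divr_ge0// ?sqr_ge0//.
have z0 : 0 < z by case/andP: xzy => xz _; exact: lt_le_trans xz.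
have [z1|z1] := leP 1 z.
  rewrite mulr_ge0 ?subr_ge0//.
  by have := ln_half_sub_inv_le _ _ ltr01 z1; rewrite ln1 invr1; lra.
rewrite mulr_le0 ?subr_le0//; first exact: ltW.
by have := ln_half_sub_inv_le _ _ z0 (ltW z1); rewrite ln1 invr1; lra.
Qed.


(* If P and Q are the Taylor polynomials at 1 of orders n + 1 and n of t^beta
   and t^(beta - 1), the derivative of t^beta - P is beta (t^(beta - 1) - Q);
   the factor beta * c makes this a square times a nonnegative quantity. *)
Lemma powR_remainder_step (P Q : R -> R) (beta c : R) :
  (forall t : R, 1 <= t -> is_derive t 1 P (beta * Q t)) -> P 1 = 1 ->
  (forall t : R, 1 <= t -> 0 <= c * (t `^ (beta - 1) - Q t)) ->
  forall t : R, 1 <= t -> 0 <= beta * c * (t `^ beta - P t).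
Proof.
move=> dP P1 cQ t t1.
suff: (beta * c * (1 `^ beta - P 1)) <= beta * c * (t `^ beta - P t).
  by rewrite powR1 P1 subrr mulr0.
apply: (@is_derive_ge0_le (fun t => beta * c * (t `^ beta - P t))
  (fun t => beta ^+ 2 * (c * (t `^ (beta - 1) - Q t)))) => // u /andP[u1 _].
  have du := dP _ u1; have u0 : 0 < u by rewrite (lt_le_trans ltr01).
  have dpow := is_derive1_powR beta u0.
  rewrite (_ : (fun _ => _) = (beta * c) *: ((@powR R) ^~ beta - P))//.
  by apply: is_derive_eq; rewrite /GRing.scale/= ?fctE/=; ring.
by rewrite mulr_ge0 ?sqr_ge0// cQ.
Qed.

(** Here and in the next three lemmas, the factor in front is a positive multiple of the first
    omitted Taylor coefficient, whose sign the remainder shares. Each lemma follows from the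
    previous one at [beta - 1]. *)
Lemma powR_remainder1 (beta t : R) : 1 <= t -> 0 <= beta * (t `^ beta - 1).
Proof.
move=> t1; rewrite -[beta in beta * _]mulr1.
apply: (@powR_remainder_step (cst 1) (cst 0)) => // u _.
  by rewrite mulr0; exact: is_derive_cst.
by rewrite mul1r subr0 powR_ge0.
Qed.

Lemma powR_remainder2 (beta t : R) : 1 <= t ->
  0 <= beta * (beta - 1) * (t `^ beta - (1 + beta * (t - 1))).
Proof.
apply: (@powR_remainder_step (fun u => 1 + beta * (u - 1)) (cst 1)).
- move=> u _; have := is_derive_cubic 1 beta 0 0 u.
  rewrite !mulr0 !mul0r !addr0 mulr1.
  by congr is_derive; apply/funext => v; rewrite !mul0r !addr0.
- by rewrite subrr mulr0 addr0.
- by move=> u u1; exact: powR_remainder1.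
Qed.

Lemma powR_remainder3 (beta t : R) : 1 <= t ->
  0 <= beta * ((beta - 1) * (beta - 2)) * (t `^ beta -
    (1 + beta * (t - 1) + beta * (beta - 1) / 2 * (t - 1) ^+ 2)).
Proof.
apply: (@powR_remainder_step
  (fun u => 1 + beta * (u - 1) + beta * (beta - 1) / 2 * (u - 1) ^+ 2)
  (fun u => 1 + (beta - 1) * (u - 1))).
- move=> u _; have := is_derive_cubic 1 beta (beta * (beta - 1) / 2) 0 u.
  rewrite (_ : beta + _ + _ = beta * (1 + (beta - 1) * (u - 1))); last by field.
  by congr is_derive; apply/funext => v; rewrite !mul0r !addr0.
- by rewrite subrr expr0n/= !mulr0 !addr0.
- move=> u u1; have := powR_remainder2 (beta - 1) _ u1.
  by rewrite (_ : beta - 1 - 1 = beta - 2)//; ring.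
Qed.

Lemma powR_remainder4 (beta t : R) : 1 <= t ->
  0 <= beta * ((beta - 1) * ((beta - 2) * (beta - 3))) * (t `^ beta -
    (1 + beta * (t - 1) + beta * (beta - 1) / 2 * (t - 1) ^+ 2 +
     beta * (beta - 1) * (beta - 2) / 6 * (t - 1) ^+ 3)).
Proof.
apply: (@powR_remainder_step
  (fun u => 1 + beta * (u - 1) + beta * (beta - 1) / 2 * (u - 1) ^+ 2 +
     beta * (beta - 1) * (beta - 2) / 6 * (u - 1) ^+ 3)
  (fun u => 1 + (beta - 1) * (u - 1) +
     (beta - 1) * (beta - 2) / 2 * (u - 1) ^+ 2)).
- move=> u _; have := is_derive_cubic 1 beta (beta * (beta - 1) / 2)
    (beta * (beta - 1) * (beta - 2) / 6) u.
  by congr is_derive; field.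
- by rewrite subrr !expr0n/= !mulr0 !addr0.
- move=> u u1; have := powR_remainder3 (beta - 1) _ u1.
  rewrite (_ : beta - 1 - 1 = beta - 2)//; last by ring.
  by rewrite (_ : beta - 1 - 2 = beta - 3)//; ring.
Qed.

(** At these exponents the factor in the remainder lemmas can vanish, and they then give no
    information. The Taylor polynomials used below are exact there. *)
Lemma powR_beta01 (t : R) : 0 <= t ->
  (t `^ 0 = 1) * (t `^ 1 = t) * (t `^ 2 = t ^+ 2).
Proof. by move=> t0; rewrite powRr0 powRr1// powR_mulrn. Qed.

Lemma powR_ge_tangent (beta t : R) : 1 <= beta -> 1 <= t ->
  1 + beta * (t - 1) <= t `^ beta.
Proof.
move=> b1 t1; have t0 : 0 <= t by lra.
move: b1; rewrite le_eqVlt => /predU1P[<-|b1].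
  by rewrite powR_beta01//; lra.
rewrite -subr_ge0; have := powR_remainder2 beta t t1.
by rewrite pmulr_rge0// mulr_gt0//; lra.
Qed.

Lemma powR_le_tangent (beta t : R) : 0 <= beta <= 1 -> 1 <= t ->
  t `^ beta <= 1 + beta * (t - 1).
Proof.
move=> /andP[b0 b1] t1; have t0 : 0 <= t by lra.
move: b0 b1; rewrite le_eqVlt => /predU1P[<- _|b0].
  by rewrite powR_beta01//; lra.
rewrite le_eqVlt => /predU1P[->|b1].
  by rewrite powR_beta01//; lra.
rewrite -subr_le0; have := powR_remainder2 beta t t1.
by rewrite nmulr_rge0// pmulr_rlt0//; lra.
Qed.

Lemma powR_ge_taylor2 (beta t : R) : 0 <= beta <= 1 -> 1 <= t ->
  1 + beta * (t - 1) + beta * (beta - 1) / 2 * (t - 1) ^+ 2 <= t `^ beta.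
Proof.
move=> /andP[b0 b1] t1; have t0 : 0 <= t by lra.
move: b0 b1; rewrite le_eqVlt => /predU1P[<- _|b0].
  by rewrite powR_beta01//; lra.
rewrite le_eqVlt => /predU1P[->|b1].
  by rewrite powR_beta01//; lra.
rewrite -subr_ge0; have := powR_remainder3 beta t t1.
by rewrite pmulr_rge0// pmulr_rgt0// nmulr_rgt0; lra.
Qed.

Lemma powR_le_taylor2 (beta t : R) : 1 <= beta <= 2 -> 1 <= t ->
  t `^ beta <= 1 + beta * (t - 1) + beta * (beta - 1) / 2 * (t - 1) ^+ 2.
Proof.
move=> /andP[b1 b2] t1; have t0 : 0 <= t by lra.
move: b1 b2; rewrite le_eqVlt => /predU1P[<- _|b1].
  by rewrite powR_beta01//; lra.
rewrite le_eqVlt => /predU1P[->|b2].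
  by rewrite powR_beta01// le_eqVlt; apply/orP; left; apply/eqP; field.
rewrite -subr_le0; have := powR_remainder3 beta t t1.
by rewrite nmulr_rge0// pmulr_rlt0 ?pmulr_rlt0//; lra.
Qed.

Lemma powR_le_taylor3 (beta t : R) : 0 <= beta <= 1 -> 1 <= t ->
  t `^ beta <= 1 + beta * (t - 1) + beta * (beta - 1) / 2 * (t - 1) ^+ 2 +
     beta * (beta - 1) * (beta - 2) / 6 * (t - 1) ^+ 3.
Proof.
move=> /andP[b0 b1] t1; have t0 : 0 <= t by lra.
move: b0 b1; rewrite le_eqVlt => /predU1P[<- _|b0].
  by rewrite powR_beta01//; lra.
rewrite le_eqVlt => /predU1P[->|b1].
  by rewrite powR_beta01//; lra.
rewrite -subr_le0; have := powR_remainder4 beta t t1.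
rewrite nmulr_rge0// pmulr_rlt0// nmulr_rlt0; last lra.
by rewrite nmulr_rgt0; lra.
Qed.

Lemma powR_ge_taylor3 (beta t : R) : 1 <= beta <= 2 -> 1 <= t ->
  1 + beta * (t - 1) + beta * (beta - 1) / 2 * (t - 1) ^+ 2 +
     beta * (beta - 1) * (beta - 2) / 6 * (t - 1) ^+ 3 <= t `^ beta.
Proof.
move=> /andP[b1 b2] t1; have t0 : 0 <= t by lra.
move: b1 b2; rewrite le_eqVlt => /predU1P[<- _|b1].
  by rewrite powR_beta01//; lra.
rewrite le_eqVlt => /predU1P[->|b2].
  by rewrite powR_beta01// le_eqVlt; apply/orP; left; apply/eqP; field.
rewrite -subr_ge0; have := powR_remainder4 beta t t1.
rewrite pmulr_rge0// pmulr_rgt0; last lra.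
by rewrite pmulr_rgt0 ?nmulr_rgt0; lra.
Qed.

(* D for the variable with values a^2 and b^2 of probabilities 1 - p and p. *)
Definition twopt_gap a b p : R :=
  (1 - p) * a ^+ 2 + p * b ^+ 2 - expR (2 * ((1 - p) * ln a + p * ln b)).

(** Taking out [a ^+ 2] turns the geometric mean into a power of the ratio [b / a] with exponent
    [2 * p], to which the Taylor bounds apply. *)
Lemma twopt_gapE a b p : 0 < a -> 0 < b -> twopt_gap a b p =
  (1 - p) * a ^+ 2 + p * b ^+ 2 - a ^+ 2 * (b / a) `^ (2 * p).
Proof.
move=> a0 b0; rewrite /twopt_gap; congr (_ - _).
rewrite /powR gt_eqF ?divr_gt0// ln_div ?posrE//.
rewrite -{2}(lnK (_ : a \in Num.pos)) ?posrE// -expRM_natl -expRD.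
by congr expR; ring.
Qed.

(** * Bounds on D for two-point laws *)

Section twopt_gap_bounds.
Variables (a b p : R).
Hypotheses (a0 : 0 < a) (ab : a <= b).
Let b0 : 0 < b. Proof. exact: lt_le_trans ab. Qed.
Let t1 : 1 <= b / a. Proof. by rewrite ler_pdivlMr// mul1r. Qed.
Let a2 : 0 < a ^+ 2. Proof. by rewrite exprn_gt0. Qed.
Let an0 : a != 0. Proof. exact: lt0r_neq0. Qed.

(** Subtracting the order-one polynomial from the mean leaves exactly [p * (b - a) ^+ 2]. For the
    two-point law this is both E_X and E_{V,F}, so it serves in both halves of the theorem. *)
Lemma twopt_gap_le_E : 1 / 2 <= p -> twopt_gap a b p <= p * (b - a) ^+ 2.
Proof.
move=> p2; rewrite twopt_gapE//.
have : 1 + 2 * p * (b / a - 1) <= (b / a) `^ (2 * p).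
  by apply: powR_ge_tangent => //; lra.
rewrite -(ler_pM2l a2) (_ : _ * (1 + _) = a ^+ 2 + 2 * p * (a * (b - a))).
  by move=> ?; lra.
by field.
Qed.

Lemma twopt_gap_ge_F : 0 <= p <= 1 / 2 -> p * (b - a) ^+ 2 <= twopt_gap a b p.
Proof.
move=> p2; rewrite twopt_gapE//.
have : (b / a) `^ (2 * p) <= 1 + 2 * p * (b / a - 1).
  by apply: powR_le_tangent => //; lra.
rewrite -(ler_pM2l a2) (_ : _ * (1 + _) = a ^+ 2 + 2 * p * (a * (b - a))).
  by move=> ?; lra.
by field.
Qed.

(** The variance of the two-point law of the square root is [p * (1 - p) * (b - a) ^+ 2], so the
    order-two polynomial accounts for the value 2V. *)
Let taylor2E : a ^+ 2 * (1 + 2 * p * (b / a - 1) +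
    2 * p * (2 * p - 1) / 2 * (b / a - 1) ^+ 2) =
  (1 - p) * a ^+ 2 + p * b ^+ 2 - 2 * (p * (1 - p) * (b - a) ^+ 2).
Proof. by field. Qed.

Lemma twopt_gap_le_V : 0 <= p <= 1 / 2 ->
  twopt_gap a b p <= 2 * (p * (1 - p) * (b - a) ^+ 2).
Proof.
move=> p2; rewrite twopt_gapE// lerBlDr -lerBlDl -taylor2E ler_pM2l//.
by apply: powR_ge_taylor2 => //; lra.
Qed.

Lemma twopt_gap_ge_V : 1 / 2 <= p <= 1 ->
  2 * (p * (1 - p) * (b - a) ^+ 2) <= twopt_gap a b p.
Proof.
move=> p2; rewrite twopt_gapE// lerBrDl -lerBrDr -taylor2E ler_pM2l//.
by apply: powR_le_taylor2 => //; lra.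
Qed.

Let taylor3E : a ^+ 2 * (1 + 2 * p * (b / a - 1) +
    2 * p * (2 * p - 1) / 2 * (b / a - 1) ^+ 2 +
    2 * p * (2 * p - 1) * (2 * p - 2) / 6 * (b / a - 1) ^+ 3) =
  (1 - p) * a ^+ 2 + p * b ^+ 2 - 2 * (p * (1 - p) * (b - a) ^+ 2)
  + 2 * p * (2 * p - 1) * (2 * p - 2) / 6 * ((b - a) ^+ 3 / a).
Proof. by field. Qed.

(** The order-three term gives the rate of convergence to 2V: the error vanishes when [a] grows with
    [b - a] fixed. Its coefficient is bounded crudely by 1. *)
Lemma twopt_gap_ge_V_asymp : 0 <= p <= 1 / 2 ->
  2 * (p * (1 - p) * (b - a) ^+ 2) - (b - a) ^+ 3 / a <= twopt_gap a b p.
Proof.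
move=> p2; rewrite twopt_gapE//.
have : (b / a) `^ (2 * p) <= _ := powR_le_taylor3 (2 * p) (b / a) ltac:(lra) t1.
rewrite -(ler_pM2l a2) taylor3E.
have : 0 <= (b - a) ^+ 3 / a by rewrite divr_ge0 ?exprn_ge0 ?subr_ge0// ltW.
set q := _ / a; move=> q0 h.
have : 2 * p * (2 * p - 1) * (2 * p - 2) / 6 <= 1.
  rewrite ler_pdivrMr// mul1r.
  have : 0 <= 2 * p * (1 - 2 * p) by rewrite mulr_ge0//; lra.
  have : 2 * p * (1 - 2 * p) <= 1 by rewrite mulr_ile1//; lra.
  by set u := 2 * p * (1 - 2 * p); nra.
by move=> /(ler_wpM2r q0); lra.
Qed.

Lemma twopt_gap_le_V_asymp : 1 / 2 <= p <= 1 ->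
  twopt_gap a b p <= 2 * (p * (1 - p) * (b - a) ^+ 2) + (b - a) ^+ 3 / a.
Proof.
move=> p2; rewrite twopt_gapE//.
have : _ <= (b / a) `^ (2 * p) := powR_ge_taylor3 (2 * p) (b / a) ltac:(lra) t1.
rewrite -(ler_pM2l a2) taylor3E.
have : 0 <= (b - a) ^+ 3 / a by rewrite divr_ge0 ?exprn_ge0 ?subr_ge0// ltW.
set q := _ / a; move=> q0 h.
have : -1 <= 2 * p * (2 * p - 1) * (2 * p - 2) / 6.
  rewrite ler_pdivlMr//.
  have : 0 <= (2 * p - 1) * (2 - 2 * p) by rewrite mulr_ge0//; lra.
  have : (2 * p - 1) * (2 - 2 * p) <= 1 by rewrite mulr_ile1//; lra.
  by set u := (2 * p - 1) * (2 - 2 * p); nra.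
by move=> /(ler_wpM2r q0); lra.
Qed.

End twopt_gap_bounds.

End real_analysis.

(** * Moments of the square root and the integral of the logarithm *)

Lemma measurable_sqrt (R : realType) : measurable_fun [set: R] (@Num.sqrt R).
Proof. by apply: continuous_measurable_fun; exact: sqrt_continuous. Qed.

Lemma measurable_lneEFin (R : realType) :
  measurable_fun [set: R] (fun x : R => lne x%:E).
Proof.
rewrite (_ : (fun _ => _) =
  fun x => if (x <= 0)%R then -oo%E else (ln x)%:E)//.
apply: measurable_fun_ifT => //.
- exact: measurable_fun_ler.
- by apply/measurable_EFinP; exact: measurable_ln.
Qed.

Section nonneg_rv.
Context {d} {T : measurableType d} {R : realType} {P : probability T R}.
Variable f : {RV P >-> R}.
Hypotheses (f0 : forall w, 0 <= f w) (finE : ('E_P[f] < +oo)%E).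
Local Notation Y := (fun w => Num.sqrt (f w)).
Let mu : R := fine 'E_P[Y].
Let S : R := fine 'E_P[f].
Let L : \bar R := (\int[P]_w lne (f w)%:E)%E.

Let mf : measurable_fun setT (f : T -> R). Proof. by []. Qed.

Let mY : measurable_fun setT Y.
Proof. exact: (measurableT_comp (measurable_sqrt R)). Qed.

Let finI : (\int[P]_w (f w)%:E < +oo)%E.
Proof. by move: finE; rewrite unlock. Qed.

Lemma nonneg_rv_Lfun1 : (f : T -> R) \in Lfun P 1.
Proof.
apply/Lfun1_integrable/integrableP; split; first exact/measurable_EFinP.
move: finE; rewrite unlock; under [in X in _ -> X]eq_integral => w _.
  rewrite /= ger0_norm//.
  over.
by [].
Qed.

Lemma sqrt_rv_Lfun2 : Y \in Lfun P 2%:E.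
Proof.
rewrite inE; apply/andP; split; rewrite inE//=.
rewrite /finite_norm unlock /Lnorm poweR_lty//=.
move: finI; congr (_ < _)%E; apply: eq_integral => w _ /=.
by rewrite powR_mulrn// -normrX sqr_sqrtr// ger0_norm.
Qed.

Lemma sqrt_rv_Lfun1 : Y \in Lfun P 1.
Proof. by apply: Lfun_subset12 sqrt_rv_Lfun2; exact: fin_num_measure. Qed.

Lemma expectation_rvE : ('E_P[f] = S%:E)%E.
Proof. by rewrite fineK// expectation_fin_num// nonneg_rv_Lfun1. Qed.

Lemma expectation_sqrt_rvE : ('E_P[Y] = mu%:E)%E.
Proof. by rewrite fineK// expectation_fin_num// sqrt_rv_Lfun1. Qed.

(** Quadratics in Y = sqrt f are written with [f] in place of Y^2, so that only the means [mu] and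
    [S] enter. *)
Lemma quadratic_sqrt_rv_Lfun1 (a b c : R) :
  (fun w => a + b * Num.sqrt (f w) + c * f w) \in Lfun P 1.
Proof.
have -> : (fun w => a + b * Num.sqrt (f w) + c * f w) =
    cst a \+ b \o* Y \+ c \o* f.
  by apply/funext => w /=; rewrite (mulrC b) (mulrC c).
rewrite !rpredD ?Lfun_scale ?Lfun_cst//; first exact: sqrt_rv_Lfun1.
exact: nonneg_rv_Lfun1.
Qed.

Lemma expectation_quadratic_sqrt_rv (a b c : R) :
  ('E_P[fun w => (a + b * Num.sqrt (f w) + c * f w)%R] =
   (a + b * mu + c * S)%:E)%E.
Proof.
have -> : (fun w => a + b * Num.sqrt (f w) + c * f w) =
    cst a \+ b \o* Y \+ c \o* f.
  by apply/funext => w /=; rewrite (mulrC b) (mulrC c).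
have := nonneg_rv_Lfun1; have := sqrt_rv_Lfun1 => Y1 f1.
rewrite !expectationD ?rpredD ?Lfun_scale ?Lfun_cst// expectation_cst.
by rewrite !expectationZl// expectation_rvE expectation_sqrt_rvE.
Qed.

Lemma variance_sqrt_rvE : ('V_P[Y] = (S - mu ^+ 2)%:E)%E.
Proof.
rewrite varianceE ?sqrt_rv_Lfun2// expectation_sqrt_rvE.
rewrite (_ : Y ^+ 2 = f); first by rewrite expectation_rvE.
by apply/funext => w; rewrite fctE sqr_sqrtr.
Qed.

Lemma expectation_sqr_sub_sqrt_rv (m : R) :
  ('E_P[fun w => ((Num.sqrt (f w) - m) ^+ 2)%R] =
   (S - mu ^+ 2 + (mu - m) ^+ 2)%:E)%E.
Proof.
rewrite (_ : (fun _ => _) =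
  fun w => m ^+ 2 + (- 2 * m) * Num.sqrt (f w) + 1 * f w).
  by rewrite expectation_quadratic_sqrt_rv; congr EFin; ring.
apply/funext => w; rewrite -[in RHS](sqr_sqrtr (f0 w)) sqrtr_sqr.
by rewrite ger0_norm ?sqrtr_ge0//; ring.
Qed.

Lemma ae_integrable_ge0 (g : T -> \bar R) : P.-integrable setT g ->
  {ae P, forall w, (0 <= g w)%E} -> (0 <= \int[P]_w g w)%E.
Proof.
move=> /integrableP[mg _] g0.
rewrite (ae_eq_integral (fun w => `|g w|%E))//.
- exact: integral_ge0.
- exact: measurableT_comp.
- by apply: filterS g0 => w g0 _; rewrite gee0_abs.
Qed.

Lemma quadratic_sqrt_rv_ge0 (a b c : R) :
  {ae P, forall w, 0 <= a + b * Num.sqrt (f w) + c * f w} ->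
  0 <= a + b * mu + c * S.
Proof.
move=> q0; rewrite -lee_fin -expectation_quadratic_sqrt_rv unlock.
apply: ae_integrable_ge0.
  exact/Lfun1_integrable/quadratic_sqrt_rv_Lfun1.
by apply: filterS q0 => w; rewrite lee_fin.
Qed.

Let mln : measurable_fun setT (fun w => lne (f w)%:E).
Proof. exact: (measurableT_comp (measurable_lneEFin R)). Qed.

Let ln_pos_lty : (\int[P]_w (fun w => lne (f w)%:E)^\+ w < +oo)%E.
Proof.
apply: le_lt_trans finI; apply: ge0_le_integral => //.
- exact: measurable_funepos.
- exact/measurable_EFinP.
- move=> w _; rewrite funeposE ge_max lee_fin f0 andbT.
  by rewrite ltW// lne_sublinear.
Qed.

Let integrable_lne_rv : (\int[P]_w (fun w => lne (f w)%:E)^\- w < +oo)%E ->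
  P.-integrable setT (fun w => lne (f w)%:E).
Proof.
move=> ln_neg_lty; apply/integrableP; split => //.
rewrite -[X in integral _ _ X]/(abse \o (fun w => lne (f w)%:E)) fune_abse.
rewrite ge0_integralD//; last 2 first.
- exact: measurable_funepos.
- exact: measurable_funeneg.
by rewrite lte_add_pinfty.
Qed.

(** The positive part of ln f is at most f, hence integrable. Integrability can fail only through
    the negative part, and then the integral is -oo. *)
Lemma integral_lne_rvP :
  L = -oo%E \/ P.-integrable setT (fun w => lne (f w)%:E).
Proof.
have [negy|neg_lty] := eqVneq (\int[P]_w (fun w => lne (f w)%:E)^\- w)%E +oo%E.
  left; rewrite /L integralE negy.
  by move: ln_pos_lty; case: (integral _ _ _).
by right; apply: integrable_lne_rv; rewrite ltey.
Qed.

(** An integrable function is finite almost everywhere, while [lne] is -oo at 0. *)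
Lemma integrable_lne_rv_gt0 : P.-integrable setT (fun w => lne (f w)%:E) ->
  {ae P, forall w, 0 < f w}.
Proof.
move=> /(integrable_ae measurableT); apply: filterS => w /(_ I).
by rewrite /lne; case: (ltP 0 (f w)).
Qed.

Let ln_rvE w : 0 < f w -> ln (f w) = 2 * ln (Num.sqrt (f w)).
Proof.
move=> fw0; rewrite -{1}(sqr_sqrtr (f0 w)) lnXn ?sqrtr_gt0//.
by rewrite mulr_natl.
Qed.

(** The factor 2 comes from ln f = 2 ln (sqrt f). The bound on ln is required at positive points
    only: either the integral is -oo, or f is almost surely positive. *)
Lemma integral_lne_rv_le (K : set R) (a b c : R) :
  {ae P, forall w, K (Num.sqrt (f w))} ->
  (forall y, 0 < y -> K y -> ln y <= a + b * y + c * y ^+ 2) ->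
  (L <= (2 * (a + b * mu + c * S))%:E)%E.
Proof.
move=> YK lnq; have [->|iln] := integral_lne_rvP; first exact: leNye.
have iq := quadratic_sqrt_rv_Lfun1 (2 * a) (2 * b) (2 * c).
have {}iq := (Lfun1_integrable _ _).1 iq.
have -> : (2 * (a + b * mu + c * S)) = 2 * a + 2 * b * mu + 2 * c * S by ring.
rewrite -expectation_quadratic_sqrt_rv unlock -sube_ge0; last first.
  by rewrite integrable_fin_num ?orbT.
rewrite -integralB//; apply: ae_integrable_ge0; first exact: integrableB.
apply: filterS2 YK (integrable_lne_rv_gt0 iln) => w Kw fw0.
rewrite lne_EFin// -EFinB lee_fin subr_ge0.
have Yw0 : 0 < Num.sqrt (f w) by rewrite sqrtr_gt0.
have := lnq _ Yw0 Kw; rewrite ln_rvE// sqr_sqrtr//.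
by lra.
Qed.

Lemma integral_lne_rv_ge (m a b c : R) : 0 < m ->
  {ae P, forall w, m <= Num.sqrt (f w)} ->
  (forall y, m <= y -> a + b * y + c * y ^+ 2 <= ln y) ->
  ((2 * (a + b * mu + c * S))%:E <= L)%E.
Proof.
move=> m0 mY' lnq.
have iq := quadratic_sqrt_rv_Lfun1 (2 * a) (2 * b) (2 * c).
have {}iq := (Lfun1_integrable _ _).1 iq.
have ae0 : {ae P, forall w,
    (0 <= lne (f w)%:E - (2 * a + 2 * b * Num.sqrt (f w) + 2 * c * f w)%:E)%E}.
  apply: filterS mY' => w mw.
  have Yw0 : 0 < Num.sqrt (f w) by exact: lt_le_trans mw.
  have fw0 : 0 < f w by rewrite -sqrtr_gt0.
  rewrite lne_EFin// -EFinB lee_fin subr_ge0.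
  by have := lnq _ mw; rewrite ln_rvE// sqr_sqrtr//; lra.
have -> : (2 * (a + b * mu + c * S)) = 2 * a + 2 * b * mu + 2 * c * S by ring.
(* Since sqrt f >= m > 0, the negative part of ln f is bounded by |2 ln m|. *)
have iln : P.-integrable setT (fun w => lne (f w)%:E).
  apply: integrable_lne_rv.
  apply: (@le_lt_trans _ _ (\int[P]_w `|2 * ln m|%:E)%E).
    apply: ae_ge0_le_integral => //; first exact: measurable_funeneg.
    apply: filterS mY' => w mw _.
    have Yw0 : 0 < Num.sqrt (f w) by exact: lt_le_trans mw.
    have fw0 : 0 < f w by rewrite -sqrtr_gt0.
    rewrite funenegE lne_EFin// -EFinN ge_max !lee_fin normr_ge0 andbT.
    rewrite lerNl (le_trans (lerNnormlW (lexx _)))//.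
    by rewrite ln_rvE// ler_pM2l// ler_ln.
  by rewrite integral_cst//= probability_setT mule1 ltry.
rewrite -expectation_quadratic_sqrt_rv unlock -sube_ge0; last first.
  by rewrite integrable_fin_num.
by rewrite -integralB//; apply: ae_integrable_ge0; first exact: integrableB.
Qed.

End nonneg_rv.

(** * The support of a law and its endpoints *)

Section support.
Context {R : realType}.
Implicit Types X : rvar R.

(** A point off the support has a null neighbourhood, hence lies in a null interval with rational
    endpoints. There are countably many of these; [unpickle] enumerates them. *)
Lemma ae_supp X : {ae rv_prob X, forall w, supp X (rv_fun X w)}.
Proof.
pose null n w := if @unpickle (rat * rat)%type n is Some (q, r)
  then rv_prob X (rv_fun X @^-1` `]ratr q, ratr r[) = 0%E ->
       ~ (ratr q < rv_fun X w < ratr r)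
  else True.
suff : {ae rv_prob X, forall w n, null n w}.
  apply: filterS => w nullw U oU Uw.
  rewrite lt_neqAle measure_ge0 andbT; apply/eqP => PU0.
  have /nbhs_ballP[e /= e0 eU] : nbhs (rv_fun X w) U by exact: open_nbhs_nbhs.
  have [|q] := @rat_in_itvoo R (rv_fun X w - e) (rv_fun X w); first by lra.
  rewrite in_itv/= => /andP[eq qX].
  have [|r] := @rat_in_itvoo R (rv_fun X w) (rv_fun X w + e); first by lra.
  rewrite in_itv/= => /andP[Xr re].
  have := nullw (pickle (q, r)); rewrite /null pickleK; apply; last first.
    by rewrite qX Xr.
  apply/eqP; rewrite -measure_le0 PU0; apply: le_measure; rewrite ?inE.
  - by rewrite -[X in measurable X]setTI; exact: measurable_funPT.
  - rewrite -[X in measurable X]setTI.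
    by apply: measurable_funPT => //; exact: open_measurable.
  - move=> v /=; rewrite in_itv/= => /andP[qv vr]; apply: eU.
    by rewrite /ball/= ltr_norml; lra.
apply: ae_foralln => n; rewrite /null.
case: unpickle => [[q r]|]; last exact: aeW.
have [P0|P0] := pselect (rv_prob X (rv_fun X @^-1` `]ratr q, ratr r[) = 0%E).
  exists (rv_fun X @^-1` `]ratr q, ratr r[); split => //.
    by rewrite -[X in measurable X]setTI; exact: measurable_funPT.
  by move=> w /=; rewrite in_itv/= => /not_implyP[_ /contrapT].
by apply: aeW => w.
Qed.

Lemma supp_subset_closed X (K : set R) : closed K ->
  {ae rv_prob X, forall w, K (rv_fun X w)} -> supp X `<=` K.
Proof.
move=> cK aeK x sx; apply: contrapT => nKx.
have P0 : rv_prob X (rv_fun X @^-1` (~` K)) = 0%E.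
  apply/negligibleP => //; rewrite -[X in measurable X]setTI.
  by apply: measurable_funPT => //; exact: (open_measurable (closed_openC cK)).
have := sx (~` K) (closed_openC cK) nKx.
by rewrite /distribution/= /pushforward P0 ltxx.
Qed.

Lemma ae_nonempty X (Q : _ -> Prop) : {ae rv_prob X, forall w, Q w} ->
  exists w, Q w.
Proof.
move=> aeQ; apply: contrapT => /forallNP nQ.
have [N [mN N0 QN]] := aeQ.
have : rv_prob X setT = 0%E.
  apply/eqP; rewrite -measure_le0 -N0 le_measure ?inE// => w _.
  by apply: QN; exact: nQ.
by rewrite probability_setT => /eqP; rewrite onee_eq0.
Qed.

Lemma supp_nonempty X : supp X !=set0.
Proof. by have [w sw] := ae_nonempty _ _ (ae_supp X); exists (rv_fun X w). Qed.

Lemma supp_ge X (k : R) : {ae rv_prob X, forall w, k <= rv_fun X w} ->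
  lbound (supp X) k.
Proof. by move=> kX x /(supp_subset_closed _ _ (@closed_ge R k) kX). Qed.

Lemma supp_le X (k : R) : {ae rv_prob X, forall w, rv_fun X w <= k} ->
  ubound (supp X) k.
Proof. by move=> kX x /(supp_subset_closed _ _ (@closed_le R k) kX). Qed.

Lemma mX_ge X (k : R) : {ae rv_prob X, forall w, k <= rv_fun X w} ->
  k <= mX X.
Proof.
by move=> /(supp_ge X) kX; apply: lb_le_inf => //; exact: supp_nonempty.
Qed.

Lemma ae_mX_le X : Xplus X -> {ae rv_prob X, forall w, mX X <= rv_fun X w}.
Proof.
move=> [X0 _]; apply: filterS (ae_supp X) => w sw; apply: ge_inf => //.
(* [inf] is a lower bound only of a set bounded from below, which nonnegativity provides. *)
by exists 0; apply: supp_ge; exact: aeW.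
Qed.

Lemma MX_le X (k : R) : {ae rv_prob X, forall w, rv_fun X w <= k} ->
  (MX X <= k%:E)%E.
Proof.
move=> /(supp_le X) kX; apply: ge_ereal_sup => _ [x sx <-].
by rewrite lee_fin kX.
Qed.

Lemma ae_le_MX X : {ae rv_prob X, forall w, ((rv_fun X w)%:E <= MX X)%E}.
Proof.
apply: filterS (ae_supp X) => w sw; apply: ereal_sup_ubound.
by exists (rv_fun X w).
Qed.

Lemma MX_ge0 X : Xplus X -> (0 <= MX X)%E.
Proof.
move=> [X0 _]; have [w] := ae_nonempty _ _ (ae_le_MX X).
by apply: le_trans; rewrite lee_fin.
Qed.

End support.

(** * The two inequalities for arbitrary random variables *)

Section bounds.
Context {R : realType}.
Implicit Types X : rvar R.

(** With z = y / b, the quadratic is ln b + (z - 1) + k (z - 1)^2, tangent to ln at b. Its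
    coefficient [k] is the value at e / b of the increasing quotient of [ln_quotient_le], hence the
    order relative to ln on either side of [e]. The bound on [q0] expresses k <= 0; it matters when
    b tends to 0. *)
Lemma ln_quadratic_touch (b e : R) : 0 < b -> 0 < e -> e != b ->
  exists q0 q1 q2 : R,
  [/\ q0 + q1 * e + q2 * e ^+ 2 = ln e,
      q0 + q1 * b + q2 * b ^+ 2 = ln b,
      q0 <= ln b - 1,
      forall y, e <= y -> q0 + q1 * y + q2 * y ^+ 2 <= ln y &
      forall y, 0 < y -> y <= e -> ln y <= q0 + q1 * y + q2 * y ^+ 2].
Proof.
move=> b0 e0 eb; have bn0 : b != 0 by exact: lt0r_neq0.
have eb1 : e / b - 1 != 0.
  rewrite subr_eq0; apply: contra eb => /eqP h.
  by rewrite -(divfK bn0 e) h mul1r.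
have sq0 : 0 < (e / b - 1) ^+ 2 by rewrite lt0r sqrf_eq0 eb1 sqr_ge0.
pose k := (ln (e / b) - e / b + 1) / (e / b - 1) ^+ 2.
have qE y : ln b - 1 + k + (1 - 2 * k) / b * y + k / b ^+ 2 * y ^+ 2 =
    ln b + (y / b - 1) + k * (y / b - 1) ^+ 2 by field.
have lnb y : 0 < y -> ln y = ln b + ln (y / b).
  by move=> y0; rewrite ln_div ?posrE//; ring.
exists (ln b - 1 + k), ((1 - 2 * k) / b), (k / b ^+ 2); split.
- by rewrite qE /k divfK ?gt_eqF// (lnb e)//; ring.
- by rewrite qE divff// subrr expr0n/= mulr0 !addr0.
- rewrite gerDl /k pmulr_lle0 ?invr_gt0//.
  have := @le_ln1Dx R (e / b - 1); rewrite addrCA subrr addr0.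
  have : 0 < e / b by rewrite divr_gt0.
  by move=> ? /(_ ltac:(lra)); lra.
- move=> y ey; have y0 : 0 < y by exact: lt_le_trans ey.
  rewrite qE (lnb y)// -addrA lerD2l.
  have := @ln_quotient_le R (e / b) (y / b).
  rewrite divr_gt0// ler_pM2r ?invr_gt0// => /(_ isT ey).
  by rewrite mulrAC -ler_pdivrMr// mulrAC -/k; lra.
- move=> y y0 ye; rewrite qE (lnb y)// -addrA lerD2l.
  have := @ln_quotient_le R (y / b) (e / b).
  rewrite divr_gt0// ler_pM2r ?invr_gt0// => /(_ isT ye).
  by rewrite -ler_pdivlMr// mulrAC -/k; lra.
Qed.

Lemma ln_le_tangent (b y : R) : 0 < b -> 0 < y -> ln y <= ln b - 1 + b^-1 * y.
Proof.
move=> b0 y0; have yb0 : 0 < y / b by rewrite divr_gt0.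
have := @le_ln1Dx R (y / b - 1); rewrite addrCA subrr addr0 ln_div ?posrE//.
by rewrite mulrC => /(_ ltac:(lra)); lra.
Qed.

Definition sqrt_mean X : R :=
  fine 'E_(rv_prob X)[fun w => Num.sqrt (rv_fun X w)].

Definition rv_mean X : R := fine 'E_(rv_prob X)[rv_fun X].

Definition ln_mean X : \bar R :=
  (\int[rv_prob X]_w lne (rv_fun X w)%:E)%E.

Lemma VXE X : Xplus X -> VX X = (rv_mean X - sqrt_mean X ^+ 2)%:E.
Proof. by move=> [X0 EX0]; exact: variance_sqrt_rvE. Qed.

Lemma EXE X : Xplus X -> EX X = (rv_mean X - sqrt_mean X ^+ 2 +
  (sqrt_mean X - Num.sqrt (mX X)) ^+ 2)%:E.
Proof. by move=> [X0 EX0]; exact: expectation_sqr_sub_sqrt_rv. Qed.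

Lemma FXE X (M : R) : Xplus X -> MX X = M%:E ->
  FX X = (rv_mean X - sqrt_mean X ^+ 2 +
  (Num.sqrt M - sqrt_mean X) ^+ 2)%:E.
Proof.
move=> [X0 EX0] XM; rewrite /FX XM -[(_ - sqrt_mean X) ^+ 2]sqrrN opprB.
rewrite -expectation_sqr_sub_sqrt_rv//; congr expectation.
by apply/funext => w; rewrite -sqrrN opprB.
Qed.

Lemma FX_fin X (F : R) : FX X = F%:E -> exists M, MX X = M%:E.
Proof.
by rewrite /FX; case: (MX X) => [M| |]//; exists M.
Qed.

Lemma DXE X : Xplus X -> DX X = ((rv_mean X)%:E - expeR (ln_mean X))%E.
Proof. by move=> [X0 EX0]; rewrite /DX expectation_rvE. Qed.

Lemma DX_le X (x : R) : Xplus X -> (x%:E <= ln_mean X)%E ->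
  (DX X <= (rv_mean X - expR x)%:E)%E.
Proof.
by move=> Xp xL; rewrite DXE// EFinB leeB//; rewrite -lee_expeR in xL.
Qed.

Lemma DX_ge X (x : R) : Xplus X -> (ln_mean X <= x%:E)%E ->
  ((rv_mean X - expR x)%:E <= DX X)%E.
Proof.
by move=> Xp xL; rewrite DXE// EFinB leeB//; rewrite -lee_expeR in xL.
Qed.

Lemma DX_le_mean X : Xplus X -> (DX X <= (rv_mean X)%:E)%E.
Proof. by move=> Xp; rewrite DXE// -[leRHS]sube0 leeB// expeR_ge0. Qed.

Lemma variance_sqrt_ge0 X : Xplus X -> 0 <= rv_mean X - sqrt_mean X ^+ 2.
Proof. by move=> Xp; rewrite -lee_fin -VXE// variance_ge0. Qed.

Lemma quadratic_sqrt_ge0 X (a b c : R) : Xplus X ->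
  {ae rv_prob X, forall w,
    0 <= a + b * Num.sqrt (rv_fun X w) + c * rv_fun X w} ->
  0 <= a + b * sqrt_mean X + c * rv_mean X.
Proof. by move=> [X0 EX0]; exact: quadratic_sqrt_rv_ge0. Qed.

Lemma ae_sqrt_mX_le X : Xplus X ->
  {ae rv_prob X, forall w, Num.sqrt (mX X) <= Num.sqrt (rv_fun X w)}.
Proof.
by move=> Xp; apply: filterS (ae_mX_le X Xp) => w; exact: ler_wsqrtr.
Qed.

Lemma ae_le_sqrt_MX X (M : R) : MX X = M%:E ->
  {ae rv_prob X, forall w, Num.sqrt (rv_fun X w) <= Num.sqrt M}.
Proof.
move=> XM; apply: filterS (ae_le_MX X) => w.
by rewrite XM lee_fin; exact: ler_wsqrtr.
Qed.

Lemma sqrt_mX_le_mean X : Xplus X -> Num.sqrt (mX X) <= sqrt_mean X.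
Proof.
move=> Xp; have := @quadratic_sqrt_ge0 X (- Num.sqrt (mX X)) 1 0 Xp.
rewrite mul1r mul0r addr0 addrC subr_ge0; apply.
apply: filterS (ae_sqrt_mX_le X Xp) => w.
by rewrite mul1r mul0r addr0 addrC subr_ge0.
Qed.

Lemma mean_le_sqrt_MX X (M : R) : Xplus X -> MX X = M%:E ->
  sqrt_mean X <= Num.sqrt M.
Proof.
move=> Xp XM; have := @quadratic_sqrt_ge0 X (Num.sqrt M) (- 1) 0 Xp.
rewrite mulN1r mul0r addr0 subr_ge0; apply.
apply: filterS (ae_le_sqrt_MX X M XM) => w.
by rewrite mulN1r mul0r addr0 subr_ge0.
Qed.

Lemma ln_mean_le_tangent X (b : R) : Xplus X -> 0 < b ->
  (ln_mean X <= (2 * (ln b - 1 + b^-1 * sqrt_mean X))%:E)%E.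
Proof.
move=> [X0 EX0] b0.
have := @integral_lne_rv_le _ _ _ _ _ X0 EX0 setT (ln b - 1) b^-1 0.
rewrite mul0r addr0; apply; first exact: aeW.
by move=> y y0 _; rewrite mul0r addr0; exact: ln_le_tangent.
Qed.

(** Jensen's inequality: the tangent to ln at E Y shows that exp (E ln X) <= (E Y)^2. *)
Lemma variance_sqrt_le_DX X : Xplus X -> (VX X <= DX X)%E.
Proof.
move=> Xp; rewrite VXE//.
have := ln_mean_le_tangent X _ Xp.
have : 0 <= sqrt_mean X.
  by rewrite (le_trans _ (sqrt_mX_le_mean X Xp))// sqrtr_ge0.
rewrite le_eqVlt => /predU1P[mu0|mu0] L_le.
  rewrite -mu0 expr0n/= subr0 DXE//.
  suff -> : ln_mean X = -oo%E by rewrite /= sube0.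
  case: (ln_mean X) L_le => [l| |]// L_le.
    (* When E Y = 0, the tangent at this point turns the bound into l <= l - 2. *)
    have := L_le (expR (l / 2)) (expR_gt0 _).
    by rewrite lee_fin -mu0 mulr0 addr0 expRK => h; exfalso; lra.
  by have := L_le 1 ltr01.
have := L_le _ mu0; rewrite mulVf ?gt_eqF// subrK.
move=> /(DX_ge _ _ Xp); apply: le_trans.
by rewrite expRM_natl lnK.
Qed.

(* For a variable of mean at distance d from an endpoint of its range, variance
   V and mean squared distance Q to that endpoint, the two-point law with the
   same moments puts mass d^2 / Q at distance Q / d from the endpoint. *)
Lemma twopt_params (V d Q : R) : 0 < d -> 0 <= V -> Q = V + d ^+ 2 ->
  [/\ (0 < d ^+ 2 / Q <= 1) /\ 0 < Q / d, d ^+ 2 / Q * (Q / d) = d,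
      d ^+ 2 / Q * (Q / d) ^+ 2 = Q,
      (1 - d ^+ 2 / Q) * (Q / d) ^+ 2 = Q * V / d ^+ 2 &
      d ^+ 2 / Q * (1 - d ^+ 2 / Q) * (Q / d) ^+ 2 = V].
Proof.
move=> d0 V0 QE; have d2 : 0 < d ^+ 2 by rewrite exprn_gt0.
have Q0 : 0 < Q by rewrite QE ltr_wpDl.
have [dn0 Qn0] : d != 0 /\ Q != 0 by rewrite !gt_eqF.
split.
- by rewrite !divr_gt0//= ler_pdivrMr// mul1r QE lerDr.
- by field; rewrite dn0.
- by field; rewrite dn0.
- have -> : V = Q - d ^+ 2 by rewrite QE addrK.
  by field; rewrite dn0.
- have -> : V = Q - d ^+ 2 by rewrite QE addrK.
  by field; rewrite dn0.
Qed.

Lemma DX_le_max V E X : Xsup V E X -> (DX X <= (Num.max (2 * V) E)%:E)%E.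
Proof.
move=> [Xp]; rewrite VXE// EXE// => -[VE] [EE].
set mu := sqrt_mean X in VE EE *; set S := rv_mean X in VE EE *.
have : 0 <= Num.sqrt (mX X) by rewrite sqrtr_ge0.
set m := Num.sqrt (mX X) in EE *; rewrite le_eqVlt => /predU1P[m0|m0].
  (* With m = 0, E_X is the mean of X, which D cannot exceed. *)
  rewrite (le_trans (DX_le_mean X Xp))// lee_fin le_max.
  by apply/orP; right; rewrite -EE -m0 subr0 subrK.
have V0 : 0 <= V by rewrite -VE variance_sqrt_ge0.
have [X0 EX0] := Xp.
have : 0 <= mu - m by rewrite subr_ge0; exact: sqrt_mX_le_mean.
set d := mu - m in EE *; rewrite le_eqVlt => /predU1P[d0|d0].
  (* The mean of Y equals its minimum here, and the constant ln m serves as the minorant of ln. *)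
  have : ((2 * ln m)%:E <= ln_mean X)%E.
    have := @integral_lne_rv_ge _ _ _ _ _ X0 EX0 m (ln m) 0 0 m0.
    rewrite !mul0r !addr0; apply; first exact: ae_sqrt_mX_le.
    by move=> y my; rewrite !mul0r !addr0 ler_ln ?posrE// (lt_le_trans m0).
  move=> /(DX_le _ _ Xp)/le_trans; apply.
  rewrite lee_fin le_max expRM_natl lnK ?posrE//; apply/orP; right.
  have -> : m = mu by rewrite /d in d0; lra.
  by rewrite -EE VE -d0 expr0n/= addr0 -VE.
have EE' : E = V + d ^+ 2 by rewrite -EE VE.
have [[p01 c0] pc pc2 p1c2 pV] := twopt_params V d E d0 V0 EE'.
set p := d ^+ 2 / E in p01 pc pc2 p1c2 pV; set c := E / d in c0 pc pc2 p1c2 pV.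
have b0 : 0 < m + c by rewrite addr_gt0.
have mb : m != m + c by rewrite lt_eqF// ltrDl.
(* The quadratic agrees with ln at both atoms [m] and [m + c], so its mean is that of ln under the
   two-point law. *)
have [q0 [q1 [q2 [qm qb _ qle _]]]] := ln_quadratic_touch (m + c) m b0 m0 mb.
have muE : mu = (1 - p) * m + p * (m + c).
  by rewrite mulrDr pc /d; ring.
have SE : S = (1 - p) * m ^+ 2 + p * (m + c) ^+ 2.
  have -> : (1 - p) * m ^+ 2 + p * (m + c) ^+ 2 =
    m ^+ 2 + 2 * m * (p * c) + p * c ^+ 2 by ring.
  rewrite pc pc2 EE' -VE /d; ring.
have LK : ((2 * ((1 - p) * ln m + p * ln (m + c)))%:E <= ln_mean X)%E.
  have := @integral_lne_rv_ge _ _ _ _ _ X0 EX0 m q0 q1 q2 m0.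
  rewrite -/(sqrt_mean X) -/(rv_mean X) -/(ln_mean X) -/mu -/S.
  have -> : q0 + q1 * mu + q2 * S = (1 - p) * ln m + p * ln (m + c).
    by rewrite muE SE -qm -qb; ring.
  by apply; first exact: ae_sqrt_mX_le.
apply: (le_trans (DX_le _ _ Xp LK)); rewrite lee_fin -/S SE.
rewrite -/(twopt_gap m (m + c) p) le_max.
have mc : m <= m + c by rewrite lerDl ltW.
(* As E = p c^2 and 2V = 2(1 - p) E, comparing p with 1/2 decides which is the maximum. *)
have [p2|p2] := leP (1 / 2) p; apply/orP; [right|left].
  rewrite (le_trans (twopt_gap_le_E m (m + c) p m0 mc p2))//.
  by rewrite addrAC subrr add0r pc2.
rewrite (le_trans (twopt_gap_le_V m (m + c) p m0 mc _))//.
  by case/andP: p01 => p0 _; rewrite !ltW.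
by rewrite addrAC subrr add0r pV.
Qed.

Lemma min_le_DX V (F : \bar R) X : Xinf V F X -> (-oo < F)%E ->
  ((Num.min (2 * V) (EVF V F))%:E <= DX X)%E.
Proof.
move=> [Xp XV XF] F0; have V_le := variance_sqrt_le_DX X Xp.
have V0 : 0 <= V by rewrite -lee_fin -XV variance_ge0.
(* For infinite F, [EVF] is V and Jensen's bound suffices. *)
case: F F0 XF => [F _ XF|_ _|//]; last first.
  rewrite (le_trans _ V_le)// XV lee_fin ge_min; apply/orP; right.
  by rewrite /EVF.
have [M XM] := FX_fin X F XF.
(* Jensen's bound D >= V will settle V = 0 and, since [EVF] is then 0, also F = V. *)
have : Num.min (2 * V) (EVF V F%:E) <= V ->
    ((Num.min (2 * V) (EVF V F%:E))%:E <= DX X)%E.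
  by move=> h; rewrite (le_trans _ V_le)// XV lee_fin.
move: V0; rewrite le_eqVlt => /predU1P[V0 +|V0].
  by apply; rewrite ge_min -V0 mulr0 lexx.
move: XF; rewrite (FXE X M Xp XM) => -[FE].
move: XV; rewrite VXE// => -[VE].
set mu := sqrt_mean X in VE FE *; set S := rv_mean X in VE FE *.
have : 0 <= Num.sqrt M by rewrite sqrtr_ge0.
have := mean_le_sqrt_MX X M Xp XM.
have aeM := ae_le_sqrt_MX X M XM.
set N := Num.sqrt M in FE aeM *; rewrite -subr_ge0 -/mu le_eqVlt.
set d := N - mu in FE *; move=> /predU1P[d0 _|d0 N0].
  apply; rewrite ge_min; apply/orP; right.
  by rewrite /EVF -FE VE -d0 expr0n/= addr0 eqxx ltW.
move=> _; have [X0 EX0] := Xp.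
have FE' : F = V + d ^+ 2 by rewrite -FE VE.
have EVFE : EVF V F%:E = F * V / d ^+ 2.
  by rewrite /EVF FE' addrC -subr_eq0 addrK gt_eqF ?exprn_gt0// addrC.
have [[p01 c0] pc pc2 p1c2 pV] := twopt_params V d F d0 (ltW V0) FE'.
set p := d ^+ 2 / F in p01 pc pc2 p1c2 pV; set c := F / d in c0 pc pc2 p1c2 pV.
have muE : mu = (1 - p) * N + p * (N - c).
  by rewrite mulrBr pc /d; ring.
have SE : S = (1 - p) * N ^+ 2 + p * (N - c) ^+ 2.
  have -> : (1 - p) * N ^+ 2 + p * (N - c) ^+ 2 =
    N ^+ 2 - 2 * N * (p * c) + p * c ^+ 2 by ring.
  rewrite pc pc2 FE' -VE /d; ring.
(* The inequality E (Y (N - Y)) >= 0 keeps the lower atom [N - c] nonnegative. *)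
have a0 : 0 <= N - c.
  have : 0 <= 0 + N * mu + (- 1) * S.
    apply: quadratic_sqrt_ge0 => //; apply: filterS aeM => w wM.
    rewrite add0r mulN1r -{2}(sqr_sqrtr (X0 w)) subr_ge0 expr2.
    by rewrite ler_wpM2r ?sqrtr_ge0.
  rewrite subr_ge0 /c ler_pdivrMr// FE' -VE /d.
  by move=> ?; lra.
have ln_le b : 0 < b -> b < N -> exists q0 q1 q2 : R,
    [/\ q0 + q1 * N + q2 * N ^+ 2 = ln N, q0 + q1 * b + q2 * b ^+ 2 = ln b,
     q0 <= ln b - 1 & (ln_mean X <= (2 * (q0 + q1 * mu + q2 * S))%:E)%E].
  move=> b0 bN; have N0' := lt_trans b0 bN.
  have [|q0 [q1 [q2 [qN qb q0b _ qle]]]] := ln_quadratic_touch b N b0 N0'.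
    by rewrite gt_eqF.
  exists q0, q1, q2; split => //.
  exact: (@integral_lne_rv_le _ _ _ _ _ X0 EX0 [set y | y <= N] q0 q1 q2).
move: a0; rewrite le_eqVlt => /predU1P[a0|a0].
  (* No quadratic touches ln at 0, but tangency points tending to 0 force
     E ln X = -oo. *)
  have cN : c = N by lra.
  have N0' : 0 < N by rewrite -cN.
  (* At the atom 0 the quadratic takes the value [q0], which is at most ln b - 1. *)
  have Lb b : 0 < b -> b < N ->
      (ln_mean X <= (2 * (p * (ln b - 1) + (1 - p) * ln N))%:E)%E.
    move=> b0 /(ln_le _ b0)[q0 [q1 [q2 [qN qb q0b /le_trans]]]]; apply.
    rewrite lee_fin ler_pM2l// muE SE -a0 expr0n/= !mulr0 !addr0 -qN.
    have -> : q0 + q1 * ((1 - p) * N) + q2 * ((1 - p) * N ^+ 2) =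
      p * q0 + (1 - p) * (q0 + q1 * N + q2 * N ^+ 2) by ring.
    by rewrite lerD2r ler_pM2l//; case/andP: p01.
  have Loo : ln_mean X = -oo%E.
    have h2 : N / 2 < N by rewrite ltr_pdivrMr// ltr_pMr// ltr1n.
    case: (ln_mean X) Lb => [l| |]// Lb; last first.
      by have := Lb (N / 2); rewrite h2 divr_gt0// => /(_ isT isT).
    have p0 : 0 < p by case/andP: p01.
    (* Chosen so that 2 (p z + (1 - p) ln N) = l; any b with ln b <= z then bounds l by l - 2p. *)
    pose z := (l / 2 - (1 - p) * ln N) / p.
    pose b := Num.min (N / 2) (expR z).
    have b0 : 0 < b by rewrite lt_min divr_gt0//= expR_gt0.
    have bN : b < N by rewrite gt_min h2.
    have lnb : ln b <= z.
      by rewrite -[z]expRK ler_ln ?posrE ?expR_gt0// /b ge_min lexx orbT.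
    have pz : p * z = l / 2 - (1 - p) * ln N by rewrite /z mulrC divfK ?gt_eqF.
    have := Lb b b0 bN; rewrite lee_fin.
    have : p * ln b <= p * z by rewrite ler_pM2l.
    by rewrite pz => h1 h3; exfalso; clear -p0 h1 h3; lra.
  rewrite DXE// Loo [expeR _]/= sube0 lee_fin ge_min; apply/orP; right.
  by rewrite EVFE -/S SE -a0 expr0n/= mulr0 addr0 -cN p1c2.
have aN : N - c < N by rewrite gtrBl.
have [q0 [q1 [q2 [qN qb _]]]] := ln_le _ a0 aN.
have -> : q0 + q1 * mu + q2 * S = p * ln (N - c) + (1 - p) * ln N.
  by rewrite muE SE -qN -qb; ring.
(* The last argument of [twopt_gap] is the mass of the upper atom, here 1 - p. *)
have -> : p * ln (N - c) + (1 - p) * ln N =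
  (1 - (1 - p)) * ln (N - c) + (1 - p) * ln N by ring.
move=> /(DX_ge _ _ Xp); apply: le_trans.
have -> : rv_mean X = (1 - (1 - p)) * (N - c) ^+ 2 + (1 - p) * N ^+ 2.
  by rewrite -/S SE; ring.
rewrite -/(twopt_gap (N - c) N (1 - p)) lee_fin ge_min.
have NcN : N - (N - c) = c by ring.
(* Since 2V is 2p times [EVF], the minimum is [EVF] exactly when p >= 1/2. *)
have [p2|p2] := leP (1 - p) (1 / 2); apply/orP; [right|left].
  rewrite (le_trans _ (twopt_gap_ge_F (N - c) N (1 - p) a0 (ltW aN) _))//.
    by rewrite NcN EVFE p1c2.
  by rewrite p2 subr_ge0; case/andP: p01 => _ ->.
rewrite (le_trans _ (twopt_gap_ge_V (N - c) N (1 - p) a0 (ltW aN) _))//.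
  by rewrite NcN -{1}pV le_eqVlt; apply/orP; left; apply/eqP; ring.
by rewrite (ltW p2)/= gerBl; case/andP: p01 => /ltW.
Qed.

End bounds.

(** * Two-point laws, parametrised by the values of the square root *)

Section twopt.
Context {R : realType}.

Definition twopt_fun (a b : R) (w : bool) : R := if w then b ^+ 2 else a ^+ 2.

Lemma measurable_twopt_fun a b : measurable_fun [set: bool] (twopt_fun a b).
Proof. by []. Qed.

HB.instance Definition _ a b :=
  @isMeasurableFun.Build _ _ bool R (twopt_fun a b) (measurable_twopt_fun a b).

Definition twopt (a b p : R) : rvar R :=
  @Rvar R _ _ (bernoulli_prob p) (twopt_fun a b : {mfun bool >-> R}).

Lemma twopt_two_values a b p : at_most_two_values (twopt a b p).
Proof.
by exists (b ^+ 2), (a ^+ 2) => _ [[] _ <-] /=; [left|right].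
Qed.

Section twopt_functionals.
Variables (a b p : R).
Hypotheses (a0 : 0 <= a) (ab : a <= b) (p0 : 0 < p) (p1 : p < 1).
Let p01 : 0 <= p <= 1. Proof. by rewrite !ltW. Qed.
Let b0 : 0 <= b. Proof. exact: le_trans ab. Qed.

(** Both points have positive mass, so the empty set is the only null set. *)
Lemma ae_bernoulli (Q : bool -> Prop) : {ae bernoulli_prob p, forall w, Q w} ->
  forall w, Q w.
Proof.
move=> [N [mN N0 QN]] w; apply: contrapT => nQw.
have : bernoulli_prob p [set w] = 0%E.
  apply/eqP; rewrite -measure_le0 -N0 le_measure ?inE// => _ ->.
  exact: QN.
rewrite bernoulli_probE//; case: w nQw => _; rewrite !diracE.
  rewrite mem_set// memNset// mule1 mule0 adde0 => -[] pE.
  by move: p0; rewrite pE ltxx.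
rewrite memNset// mem_set// mule1 mule0 add0e => -[] pE.
by move: p1; rewrite -subr_gt0 -/(onem p) pE ltxx.
Qed.

Lemma integral_bernoulli_EFin (g : bool -> R) :
  (\int[bernoulli_prob p]_w (g w)%:E = (p * g true + (1 - p) * g false)%:E)%E.
Proof.
rewrite integralE !integral_bernoulli_prob// !funeposE !funenegE.
rewrite -!EFinN -!EFin_max -!EFinM -!EFinD; congr EFin.
have max_sub (x : R) : Num.max x 0 - Num.max (- x) 0 = x.
  by case: (leP x 0); case: (leP (- x) 0) => *; lra.
by rewrite -[g true in RHS]max_sub -[g false in RHS]max_sub /onem; ring.
Qed.

Lemma twopt_Xplus : Xplus (twopt a b p).
Proof.
split; first by case; rewrite sqr_ge0.
by rewrite unlock integral_bernoulli_EFin ltry.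
Qed.

Lemma twopt_mean : rv_mean (twopt a b p) = (1 - p) * a ^+ 2 + p * b ^+ 2.
Proof. by rewrite /rv_mean unlock integral_bernoulli_EFin/= addrC. Qed.

Lemma twopt_sqrt_mean : sqrt_mean (twopt a b p) = (1 - p) * a + p * b.
Proof.
rewrite /sqrt_mean unlock integral_bernoulli_EFin/= !sqrtr_sqr !ger0_norm//.
exact: addrC.
Qed.

Lemma twopt_mX : mX (twopt a b p) = a ^+ 2.
Proof.
apply/eqP; rewrite eq_le; apply/andP; split.
  exact: (ae_bernoulli _ (ae_mX_le _ twopt_Xplus) false).
apply: mX_ge; apply: aeW => -[]//=.
by rewrite /twopt_fun lerXn2r.
Qed.

Lemma twopt_MX : MX (twopt a b p) = (b ^+ 2)%:E.
Proof.
apply/eqP; rewrite eq_le; apply/andP; split; last first.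
  exact: (ae_bernoulli _ (ae_le_MX (twopt a b p)) true).
apply: MX_le; apply: aeW => -[]//=.
by rewrite /twopt_fun lerXn2r.
Qed.

Lemma twopt_VX : VX (twopt a b p) = (p * (1 - p) * (b - a) ^+ 2)%:E.
Proof.
rewrite VXE; last exact: twopt_Xplus.
by rewrite twopt_mean twopt_sqrt_mean; congr EFin; ring.
Qed.

Lemma twopt_EX : EX (twopt a b p) = (p * (b - a) ^+ 2)%:E.
Proof.
rewrite EXE; last exact: twopt_Xplus.
rewrite twopt_mean twopt_sqrt_mean twopt_mX sqrtr_sqr ger0_norm//.
by congr EFin; ring.
Qed.

Lemma twopt_FX : FX (twopt a b p) = ((1 - p) * (b - a) ^+ 2)%:E.
Proof.
rewrite (FXE _ _ twopt_Xplus twopt_MX).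
rewrite twopt_mean twopt_sqrt_mean sqrtr_sqr ger0_norm//.
by congr EFin; ring.
Qed.

Lemma twopt_DX : 0 < a -> DX (twopt a b p) = (twopt_gap a b p)%:E.
Proof.
move=> agt0; have bgt0 : 0 < b by exact: lt_le_trans ab.
rewrite DXE; last exact: twopt_Xplus.
have -> : ln_mean (twopt a b p) = (2 * ((1 - p) * ln a + p * ln b))%:E.
  rewrite /ln_mean.
  transitivity (\int[bernoulli_prob p]_w (ln (twopt_fun a b w))%:E)%E.
    apply: eq_integral => w _; rewrite lne_EFin//.
    by case: w; rewrite exprn_gt0.
  rewrite integral_bernoulli_EFin/= !lnXn// !mulr2n; congr EFin; ring.
by rewrite /= -EFinB twopt_mean.
Qed.

(** The atom at 0 has positive mass, which excludes integrability of ln X; hence E ln X = -oo and D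
    is the mean. *)
Lemma twopt_DX0 : a = 0 -> DX (twopt a b p) = (p * b ^+ 2)%:E.
Proof.
move=> a00; have [X0 EX0] := twopt_Xplus.
rewrite DXE; last exact: twopt_Xplus.
have := integral_lne_rvP _ X0 EX0; rewrite -/(ln_mean _).
move=> [->|/integrable_lne_rv_gt0].
  by rewrite /= sube0 twopt_mean a00 expr0n/= mulr0 add0r.
move=> /ae_bernoulli/(_ false).
by rewrite /= /twopt_fun a00 expr0n ltxx.
Qed.

End twopt_functionals.
End twopt.

(** * Degenerate laws, and two-point laws that approach the bounds *)

Section attainment.
Context {R : realType}.
Implicit Types X Z : rvar R.

Lemma quadratic_sqrt_eq0 X (a b c : R) : Xplus X ->
  {ae rv_prob X, forall w,
    0 <= a + b * Num.sqrt (rv_fun X w) + c * rv_fun X w} ->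
  a + b * sqrt_mean X + c * rv_mean X = 0 ->
  {ae rv_prob X, forall w,
    a + b * Num.sqrt (rv_fun X w) + c * rv_fun X w = 0}.
Proof.
move=> [X0 EX0] q0 Eq0.
pose q w := (a + b * Num.sqrt (rv_fun X w) + c * rv_fun X w)%:E.
have mq : measurable_fun setT q.
  have := quadratic_sqrt_rv_Lfun1 _ X0 EX0 a b c.
  by move=> /Lfun1_integrable/integrableP[].
have : (\int[rv_prob X]_w `|q w| = 0)%E.
  rewrite (ae_eq_integral q)//; first last.
  - by apply: filterS q0 => w qw _; rewrite gee0_abs.
  - exact: measurableT_comp.
  have := expectation_quadratic_sqrt_rv _ X0 EX0 a b c.
  by rewrite -/(sqrt_mean X) -/(rv_mean X) Eq0 unlock.
move=> /(ae_eq_integral_abs _ measurableT mq); apply: filterS => w /(_ I).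
by move=> [].
Qed.

(** Each of the two moments is pinned by a pair of opposite inequalities. *)
Lemma sqrt_ae_cst X (k : R) : Xplus X ->
  {ae rv_prob X, forall w, Num.sqrt (rv_fun X w) = k} -> VX X = 0%E.
Proof.
move=> Xp Xk; have [X0 _] := Xp; rewrite VXE//.
have muk : sqrt_mean X = k.
  have := @quadratic_sqrt_ge0 _ X (- k) 1 0 Xp.
  have := @quadratic_sqrt_ge0 _ X k (- 1) 0 Xp.
  rewrite !mul0r !addr0 => h1 h2.
  have {}h1 : 0 <= k + -1 * sqrt_mean X.
    by apply: h1; apply: filterS Xk => w ->; lra.
  have {}h2 : 0 <= - k + 1 * sqrt_mean X.
    by apply: h2; apply: filterS Xk => w ->; lra.
  lra.
have Sk : rv_mean X = k ^+ 2.
  have := @quadratic_sqrt_ge0 _ X (- k ^+ 2) 0 1 Xp.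
  have := @quadratic_sqrt_ge0 _ X (k ^+ 2) 0 (- 1) Xp.
  rewrite !mul0r !addr0 => h1 h2.
  have {}h1 : 0 <= k ^+ 2 + -1 * rv_mean X.
    apply: h1; apply: filterS Xk => w wk.
    by rewrite mul0r addr0 -{1}wk sqr_sqrtr//; lra.
  have {}h2 : 0 <= - k ^+ 2 + 1 * rv_mean X.
    apply: h2; apply: filterS Xk => w wk.
    by rewrite mul0r addr0 -{1}wk sqr_sqrtr//; lra.
  lra.
by rewrite Sk muk subrr.
Qed.

Lemma VX0_ae_cst X : Xplus X -> VX X = 0%E ->
  {ae rv_prob X, forall w, rv_fun X w = sqrt_mean X ^+ 2}.
Proof.
move=> Xp; have [X0 _] := Xp; rewrite VXE// => -[V0].
have quadE w : sqrt_mean X ^+ 2 + (- 2 * sqrt_mean X) *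
    Num.sqrt (rv_fun X w) + 1 * rv_fun X w =
    (Num.sqrt (rv_fun X w) - sqrt_mean X) ^+ 2.
  by rewrite -[X in 1 * X](sqr_sqrtr (X0 w)); ring.
have := @quadratic_sqrt_eq0 X (sqrt_mean X ^+ 2) (- 2 * sqrt_mean X) 1 Xp.
have -> : sqrt_mean X ^+ 2 + - 2 * sqrt_mean X * sqrt_mean X +
  1 * rv_mean X = rv_mean X - sqrt_mean X ^+ 2 by ring.
rewrite V0 => h; have {}h := h _ erefl.
have : {ae rv_prob X, forall w, sqrt_mean X ^+ 2 + - 2 * sqrt_mean X *
    Num.sqrt (rv_fun X w) + 1 * rv_fun X w = 0}.
  by apply: h; apply: aeW => w; rewrite quadE sqr_ge0.
apply: filterS => w; rewrite quadE => /eqP.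
by rewrite sqrf_eq0 subr_eq0 => /eqP <-; rewrite sqr_sqrtr.
Qed.

Lemma sqrt_mean_ge0 X : 0 <= sqrt_mean X.
Proof. by rewrite fine_ge0// expectation_ge0// => w; exact: sqrtr_ge0. Qed.

Lemma VX0_EX0 X : Xplus X -> VX X = 0%E -> EX X = 0%E.
Proof.
move=> Xp V0; have := VX0_ae_cst X Xp V0 => Xc.
have : mX X = sqrt_mean X ^+ 2.
  apply/eqP; rewrite eq_le; apply/andP; split.
    have [w [<-]] : exists w,
        rv_fun X w = sqrt_mean X ^+ 2 /\ mX X <= rv_fun X w.
      by apply: (@ae_nonempty _ X); apply: filterS2 Xc (ae_mX_le X Xp).
    by [].
  by apply: mX_ge; apply: filterS Xc => w ->.
move=> mXE; move: V0; rewrite VXE// => -[V0].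
by rewrite EXE// V0 mXE sqrtr_sqr ger0_norm ?sqrt_mean_ge0// subrr expr0n addr0.
Qed.

Lemma VX0_FX0 X : Xplus X -> VX X = 0%E -> FX X = 0%E.
Proof.
move=> Xp V0; have := VX0_ae_cst X Xp V0 => Xc.
have MXE : MX X = (sqrt_mean X ^+ 2)%:E.
  apply/eqP; rewrite eq_le; apply/andP; split.
    by apply: MX_le; apply: filterS Xc => w ->.
  have [w [<-]] : exists w,
      rv_fun X w = sqrt_mean X ^+ 2 /\ ((rv_fun X w)%:E <= MX X)%E.
    by apply: (@ae_nonempty _ X); apply: filterS2 Xc (ae_le_MX X).
  by [].
move: V0; rewrite VXE// => -[V0].
rewrite (FXE X _ Xp MXE) V0 sqrtr_sqr ger0_norm ?sqrt_mean_ge0//.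
by rewrite subrr expr0n addr0.
Qed.

(** E_X - V_X is the square of E Y - sqrt m_X, so equality puts the mean of Y at its minimum and Y
    is almost surely constant. For V > 0 this yields E > V, the nondegeneracy needed in
    [twopt_params]. *)
Lemma VX_eq_EX X : Xplus X -> EX X = VX X -> VX X = 0%E.
Proof.
move=> Xp; rewrite EXE// {1}VXE// => -[] /eqP.
rewrite -subr_eq0 addrAC subrr add0r sqrf_eq0 => /eqP d0.
apply: (@sqrt_ae_cst _ (Num.sqrt (mX X))) => //.
have := @quadratic_sqrt_eq0 X (- Num.sqrt (mX X)) 1 0 Xp.
rewrite mul0r addr0 mul1r addrC d0 => h.
apply: filterS (h _ erefl) => [w|]; first by rewrite mul0r addr0 mul1r; lra.
apply: filterS (ae_sqrt_mX_le X Xp) => w.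
by rewrite mul0r addr0 mul1r; lra.
Qed.

Lemma VX_eq_FX X (M : R) : Xplus X -> MX X = M%:E -> FX X = VX X ->
  VX X = 0%E.
Proof.
move=> Xp XM; rewrite (FXE X M Xp XM) {1}VXE// => -[] /eqP.
rewrite -subr_eq0 addrAC subrr add0r sqrf_eq0 => /eqP d0.
apply: (@sqrt_ae_cst _ (Num.sqrt M)) => //.
have := @quadratic_sqrt_eq0 X (Num.sqrt M) (- 1) 0 Xp.
rewrite mul0r addr0 mulN1r d0 => h.
apply: filterS (h _ erefl) => [w|]; first by rewrite mul0r addr0 mulN1r; lra.
apply: filterS (ae_le_sqrt_MX X M XM) => w.
by rewrite mul0r addr0 mulN1r; lra.
Qed.

(** For 0 < V < E, the laws on {a, a + c} with mass p at the upper atom lie in the class for every a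
    >= 0. If p >= 1/2 the maximum is E, attained at a = 0; otherwise it is 2V, approached as a
    grows. *)
Lemma Xsup2_approx V E X (e : R) : Xsup V E X -> 0 < e ->
  exists2 Z, Xsup2 V E Z & ((Num.max (2 * V) E - e)%:E <= DX Z)%E.
Proof.
move=> [Xp XV XE] e0.
have V0 : 0 <= V by rewrite -lee_fin -XV variance_ge0.
have EV : V <= E.
  rewrite -lee_fin -XV -XE VXE// EXE// lee_fin lerDl sqr_ge0//.
move: V0; rewrite le_eqVlt => /predU1P[V0|V0].
  have E0 : E = 0.
    by move: XE; rewrite VX0_EX0// ?XV -?V0// => -[].
  (* If V = E = 0 a constant will do: both atoms are placed at 1. *)
  have h20 : (0 : R) < 2^-1 by rewrite invr_gt0.
  have h21 : (2^-1 : R) < 1 by rewrite invf_lt1 ?ltr1n.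
  have Zp := @twopt_Xplus R 1 1 2^-1 h20 h21.
  have ZV : VX (@twopt R 1 1 2^-1) = 0%E.
    by rewrite twopt_VX// subrr expr0n/= mulr0.
  exists (twopt 1 1 2^-1).
    split; last exact: twopt_two_values.
    by split; rewrite -?V0 ?E0 ?ZV ?VX0_EX0.
  rewrite (le_trans _ (variance_sqrt_le_DX _ Zp))// ZV -V0 E0 mulr0 maxxx.
  by rewrite lee_fin; lra.
move: EV; rewrite le_eqVlt => /predU1P[EV|EV].
  have : VX X = 0%E by apply: VX_eq_EX => //; rewrite XV XE EV.
  by rewrite XV => -[] V00; move: V0; rewrite V00 ltxx.
have E0 : 0 < E by exact: lt_trans EV.
pose d := Num.sqrt (E - V).
have d0 : 0 < d by rewrite sqrtr_gt0 subr_gt0.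
have EE : E = V + d ^+ 2 by rewrite sqr_sqrtr ?subr_ge0 ?ltW// subrKC.
have [[/andP[p0 _] c0] pc pc2 _ pV] := twopt_params V d E d0 (ltW V0) EE.
set p := d ^+ 2 / E in p0 pc pc2 pV; set c := E / d in c0 pc pc2 pV.
have p1 : p < 1 by rewrite ltr_pdivrMr// mul1r EE ltrDr.
have ac a : a + c - a = c by ring.
have aac a : a <= a + c by rewrite lerDl ltW.
have Zsup a : 0 <= a -> Xsup2 V E (twopt a (a + c) p).
  move=> a0.
  split; last exact: twopt_two_values.
  split; first exact: twopt_Xplus.
    by rewrite twopt_VX// ac pV.
  by rewrite twopt_EX// ac pc2.
have [p2|p2] := leP (1 / 2) p.
  exists (twopt 0 (0 + c) p); first exact: Zsup.
  rewrite twopt_DX0 ?add0r ?(ltW c0)// pc2 lee_fin.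
  rewrite (_ : Num.max _ _ = E) ?gerBl ?ltW//; apply/max_idPr.
  rewrite -pV mulrAC pc2; nra.
(* With this lower atom the error term of [twopt_gap_ge_V_asymp] equals [e]. *)
have a0 : 0 < c ^+ 3 / e by rewrite divr_gt0// exprn_gt0.
exists (twopt (c ^+ 3 / e) (c ^+ 3 / e + c) p); first exact: Zsup (ltW a0).
rewrite (twopt_DX _ _ _ (aac _) p0 p1 a0) lee_fin.
have := @twopt_gap_ge_V_asymp R _ _ p a0 (aac _).
rewrite ac (ltW p0) (ltW p2) pV => /(_ isT).
rewrite (_ : c ^+ 3 / _ = e); last first.
  by rewrite invf_div mulrCA divff ?mulr1// expf_neq0// gt_eqF.
rewrite (_ : Num.max _ _ = 2 * V)//; apply/max_idPl.
rewrite -pV mulrAC pc2; nra.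
Qed.

(** F measures the distance to the upper atom, so the mass p now sits on the lower one. For 0 < V <
    F the minimum is [EVF] if p >= 1/2, attained with lower atom 0; otherwise it is 2V, approached
    as the lower atom grows. *)
Lemma Xinf2_approx V F X (e : R) : Xinf V F%:E X -> 0 < e ->
  exists2 Z, Xinf2 V F%:E Z &
    (DX Z <= (Num.min (2 * V) (EVF V F%:E) + e)%:E)%E.
Proof.
move=> [Xp XV XF] e0.
have V0 : 0 <= V by rewrite -lee_fin -XV variance_ge0.
have [M XM] := FX_fin X F XF.
have FV : V <= F.
  rewrite -lee_fin -XV -XF VXE// (FXE X M)// lee_fin lerDl sqr_ge0//.
move: V0; rewrite le_eqVlt => /predU1P[V0|V0].
  have F0 : F = 0.
    by move: XF; rewrite VX0_FX0// ?XV -?V0// => -[].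
  have h20 : (0 : R) < 2^-1 by rewrite invr_gt0.
  have h21 : (2^-1 : R) < 1 by rewrite invf_lt1 ?ltr1n.
  have Zp := @twopt_Xplus R 1 1 2^-1 h20 h21.
  have ZV : VX (@twopt R 1 1 2^-1) = 0%E.
    by rewrite twopt_VX// subrr expr0n/= mulr0.
  (* With V = E = 0, the upper bound [DX_le_max] yields D <= 0. *)
  have Zsup : Xsup 0 0 (@twopt R 1 1 2^-1) by split; rewrite ?VX0_EX0.
  exists (twopt 1 1 2^-1).
    split; last exact: twopt_two_values.
    by split; rewrite -?V0 ?F0 ?ZV ?VX0_FX0.
  rewrite (le_trans (DX_le_max 0 0 _ Zsup))// lee_fin -V0 F0 /EVF eqxx.
  by rewrite mulr0 maxxx minxx add0r ltW.
move: FV; rewrite le_eqVlt => /predU1P[FV|FV].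
  have : VX X = 0%E by apply: (VX_eq_FX X M) => //; rewrite XV XF FV.
  by rewrite XV => -[] V00; move: V0; rewrite V00 ltxx.
have F0 : 0 < F by exact: lt_trans FV.
pose d := Num.sqrt (F - V).
have d0 : 0 < d by rewrite sqrtr_gt0 subr_gt0.
have FE : F = V + d ^+ 2 by rewrite sqr_sqrtr ?subr_ge0 ?ltW// subrKC.
have [[/andP[p0 _] c0] pc pc2 p1c2 pV] := twopt_params V d F d0 (ltW V0) FE.
set p := d ^+ 2 / F in p0 pc pc2 p1c2 pV.
set c := F / d in c0 pc pc2 p1c2 pV.
have EVFE : EVF V F%:E = (1 - p) * c ^+ 2.
  rewrite p1c2 /EVF gt_eqF//; congr (_ / _).
  by rewrite FE addrAC subrr add0r.
have p1 : p < 1 by rewrite ltr_pdivrMr// mul1r FE ltrDr.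
have r0 : 0 < 1 - p by rewrite subr_gt0.
have r1 : 1 - p < 1 by rewrite gtrBl.
have ac a : a + c - a = c by ring.
have rV : (1 - p) * (1 - (1 - p)) * c ^+ 2 = V.
  by rewrite subKr [(1 - p) * p]mulrC.
have aac a : a <= a + c by rewrite lerDl ltW.
have Zinf a : 0 <= a -> Xinf2 V F%:E (twopt a (a + c) (1 - p)).
  move=> a0.
  split; last exact: twopt_two_values.
  split; first exact: twopt_Xplus.
    by rewrite twopt_VX// ac rV.
  by rewrite twopt_FX// ac subKr pc2.
have c20 : 0 < c ^+ 2 by rewrite exprn_gt0.
have [p2|p2] := leP (1 / 2) p.
  exists (twopt 0 (0 + c) (1 - p)); first exact: Zinf.
  rewrite twopt_DX0 ?add0r ?(ltW c0)// lee_fin.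
  rewrite (_ : Num.min _ _ = (1 - p) * c ^+ 2) ?lerDl ?ltW//.
  rewrite EVFE; apply/min_idPr.
  rewrite -pV mulrA ler_pM2r//; nra.
have a0 : 0 < c ^+ 3 / e by rewrite divr_gt0// exprn_gt0.
exists (twopt (c ^+ 3 / e) (c ^+ 3 / e + c) (1 - p)).
  exact: Zinf (ltW a0).
rewrite (twopt_DX _ _ _ (aac _) r0 r1 a0) lee_fin.
have := @twopt_gap_le_V_asymp R _ _ (1 - p) a0 (aac _).
rewrite ac rV.
rewrite (_ : c ^+ 3 / (_ / e) = e); last first.
  by rewrite invf_div mulrCA divff ?mulr1// expf_neq0// gt_eqF.
rewrite (_ : Num.min _ _ = 2 * V); first by apply; lra.
rewrite EVFE; apply/min_idPl.
rewrite -pV mulrA ler_pM2r//; nra.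
Qed.

End attainment.

(** * Mixing with an atom at 0, for infinite F *)

Section dilution.
Context {R : realType}.
Variables (X : rvar R) (p s : R).
Hypotheses (Xp : Xplus X) (p0 : 0 < p) (p1 : p <= 1) (s0 : 0 < s).

Let onem_p_ge0 : 0 <= 1 - p. Proof. by rewrite subr_ge0. Qed.

(** The sample space is the line itself, so that the law of X can be mixed with a Dirac mass. *)
Definition dilution_measure : set R -> \bar R :=
  measure_add (mscale (NngNum onem_p_ge0) (@dirac _ R 0 R))
    (mscale (NngNum (ltW p0)) (distribution (rv_prob X) (rv_fun X))).

HB.instance Definition _ := Measure.on dilution_measure.

Let dilution_setT : dilution_measure setT = 1%E.
Proof.
transitivity ((1 - p)%:E * (@dirac _ R 0%R R) setT +
  p%:E * distribution (rv_prob X) (rv_fun X) setT)%E.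
  by rewrite /dilution_measure measure_addE.
rewrite diracT probability_setT.
by rewrite !mule1 -EFinD subrK.
Qed.

HB.instance Definition _ :=
  Measure_isProbability.Build _ _ _ dilution_measure dilution_setT.

(** [Xplus] asks for nonnegativity at every sample point, here every real number; the absolute value
    ensures it and leaves the values of X unchanged. *)
Definition dilution_fun (x : R) : R := s * `|x|.

Let measurable_dilution_fun : measurable_fun setT dilution_fun.
Proof. by apply: measurable_funM => //; exact: measurable_normr. Qed.

HB.instance Definition _ := @isMeasurableFun.Build _ _ _ _ dilution_fun
  measurable_dilution_fun.

Definition dilution : rvar R := @Rvar R _ _ dilution_measure dilution_fun.

Lemma ge0_integral_dilution (h : R -> R) : measurable_fun setT h ->
  (forall x, 0 <= h x) -> (\int[dilution_measure]_x (h x)%:E =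
   ((1 - p) * h 0)%:E + p%:E * \int[rv_prob X]_w (h (rv_fun X w))%:E)%E.
Proof.
move=> mh h0.
have mEh : measurable_fun setT (EFin \o h) by exact/measurable_EFinP.
rewrite ge0_integral_measure_add//; last by move=> x _; rewrite lee_fin.
rewrite !ge0_integral_mscale//=; last 2 first.
- by move=> x _; rewrite lee_fin.
- by move=> x _; rewrite lee_fin.
rewrite integral_dirac//= diracT mul1e EFinM; congr (_ + _ * _)%E.
by rewrite ge0_integral_distribution//= => x; rewrite lee_fin.
Qed.

Let X0 : forall w, 0 <= rv_fun X w. Proof. by case: Xp. Qed.
Let EX_lty : ('E_(rv_prob X)[rv_fun X] < +oo)%E. Proof. by case: Xp. Qed.

Let expectation_dilution :
  ('E_(rv_prob dilution)[rv_fun dilution] = (p * s * rv_mean X)%:E)%E.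
Proof.
have := expectation_quadratic_sqrt_rv _ X0 EX_lty 0 0 s.
rewrite -/(rv_mean X) !mul0r !add0r unlock => Es.
rewrite ge0_integral_dilution//; last first.
  by move=> x; rewrite /dilution_fun mulr_ge0// ltW.
rewrite /= /dilution_fun normr0 !mulr0 add0e -mulrA EFinM -Es; congr (_ * _)%E.
by apply: eq_integral => w _; rewrite ger0_norm// mul0r !add0r.
Qed.

Lemma dilution_Xplus : Xplus dilution.
Proof.
split; last by rewrite expectation_dilution ltry.
by move=> x; rewrite mulr_ge0// ltW.
Qed.

Lemma dilution_mean : rv_mean dilution = p * s * rv_mean X.
Proof. by rewrite /rv_mean expectation_dilution. Qed.

Lemma dilution_sqrt_mean :
  sqrt_mean dilution = p * Num.sqrt s * sqrt_mean X.
Proof.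
have := expectation_quadratic_sqrt_rv _ X0 EX_lty 0 (Num.sqrt s) 0.
rewrite -/(sqrt_mean X) !mul0r addr0 add0r unlock => Es.
set mu := sqrt_mean X in Es *.
rewrite /sqrt_mean unlock ge0_integral_dilution; last 2 first.
- exact: (measurableT_comp (measurable_sqrt R)).
- by move=> x; exact: sqrtr_ge0.
rewrite /= /dilution_fun normr0 !mulr0 sqrtr0 mulr0 add0e -mulrA.
rewrite (_ : integral _ _ _ = (Num.sqrt s * mu)%:E); first by [].
rewrite -Es; apply: eq_integral => w _.
by rewrite ger0_norm// sqrtrM ?(ltW s0)// mul0r addr0 add0r.
Qed.

Lemma dilution_MX : MX X = +oo%E -> MX dilution = +oo%E.
Proof.
move=> MXoo; case E : (MX dilution) (MX_ge0 _ dilution_Xplus) => [M| |]// _.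
have : (MX X <= (M / s)%:E)%E.
  (* As p > 0, a null set of the mixture is null for the law of X, so its preimage is an exceptional
     set for X. *)
  apply: MX_le; have [N [mN N0 QN]] := ae_le_MX dilution.
  exists (rv_fun X @^-1` N); split.
  - by rewrite -[X in measurable X]setTI; exact: measurable_funPT.
  - move: N0; rewrite /= /dilution_measure measure_addE => /eqP.
    rewrite padde_eq0// => /andP[_]; rewrite mule_eq0 => /orP[|/eqP//].
    by rewrite eqe gt_eqF.
  - move=> w /= Mw; apply: QN => /=; apply: contra_not Mw.
    by rewrite E lee_fin /dilution_fun ger0_norm// ler_pdivlMr// mulrC.
by rewrite MXoo.
Qed.

End dilution.

(** The diluted root has variance p s (S - p mu^2), which the choice of [s] makes equal to V. The
    diluted mean is then V + p s (p mu^2), with p s <= 1 and p mu^2 <= e, and D is at most this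
    mean. *)
Lemma Xinf_approx_pinfty {R : realType} (V : R) (X : rvar R) (e : R) :
  Xinf V +oo%E X -> 0 < e ->
  exists2 Z, Xinf V +oo%E Z & (DX Z <= (V + e)%:E)%E.
Proof.
move=> [Xp XV XF] e0.
have MXoo : MX X = +oo%E.
  case E : (MX X) (MX_ge0 X Xp) => [M| |]// _.
  by move: XF; rewrite (FXE X M Xp E).
have V0 : 0 < V.
  rewrite lt_neqAle -(lee_fin 0) -XV variance_ge0 andbT; apply/eqP => V0.
  by move: XF; rewrite VX0_FX0// XV -V0.
move: (XV); rewrite VXE// => -[VE].
set mu := sqrt_mean X in VE; set S := rv_mean X in VE.
have mu2 := sqr_ge0 mu.
have D0 : 0 < e + mu ^+ 2 + 1 by lra.
pose p := e / (e + mu ^+ 2 + 1).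
have p0 : 0 < p by rewrite divr_gt0.
have p1 : p <= 1 by rewrite ler_pdivrMr// mul1r; lra.
have pmu : p * mu ^+ 2 <= e.
  rewrite /p mulrAC ler_pdivrMr// ler_pM2l//; lra.
have SV : V <= S - p * mu ^+ 2.
  have : p * mu ^+ 2 <= 1 * mu ^+ 2 by rewrite ler_wpM2r.
  by rewrite -VE; lra.
have SV0 : 0 < S - p * mu ^+ 2 by exact: lt_le_trans SV.
pose s := V / (p * (S - p * mu ^+ 2)).
have s0 : 0 < s by rewrite divr_gt0// mulr_gt0.
have sE : p * s * (S - p * mu ^+ 2) = V.
  by rewrite /s; field; rewrite !gt_eqF.
have Zp := dilution_Xplus X p s Xp p0 p1 s0.
have ZV : VX (dilution X p s p0 p1) = V%:E.
  rewrite VXE// dilution_mean// dilution_sqrt_mean//.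
  rewrite 2!exprMn sqr_sqrtr ?(ltW s0)// -/mu -/S -sE; congr EFin; ring.
exists (dilution X p s p0 p1).
  by split => //; rewrite /FX dilution_MX.
rewrite (le_trans (DX_le_mean _ Zp))// lee_fin dilution_mean// -/S.
have -> : p * s * S = V + p * s * (p * mu ^+ 2) by rewrite -[in RHS]sE; ring.
rewrite lerD2l (le_trans _ pmu)// ler_piMl//; first by rewrite mulr_ge0// ltW.
by rewrite -(ler_pM2r SV0) sE mul1r.
Qed.

Theorem theorem1 (R : realType) (V E : R) (F : \bar R) (hF : (-oo < F)%E) :
  [/\ (exists X, Xsup V E X) ->
        ereal_sup (DX_image (Xsup V E)) = (Num.max (2 * V) E)%:E,
      (exists X, Xinf V F X) ->
        ereal_inf (DX_image (Xinf V F)) = (Num.min (2 * V) (EVF V F))%:E,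
      (exists X, Xsup2 V E X) ->
        ereal_sup (DX_image (Xsup2 V E)) = (Num.max (2 * V) E)%:E &
      (exists X, Xinf2 V F X) ->
        ereal_inf (DX_image (Xinf2 V F)) = (Num.min (2 * V) (EVF V F))%:E].
Proof.
(* Any class between the two-valued one and the full one has the same supremum: the bound holds on
   the larger class, the approximants lie in the smaller. *)
have supE A : (forall Z, Xsup2 V E Z -> A Z) -> (forall Z, A Z -> Xsup V E Z) ->
    (exists X, A X) -> ereal_sup (DX_image A) = (Num.max (2 * V) E)%:E.
  move=> subA Asub [X /Asub VEX]; apply/eqP; rewrite eq_le; apply/andP; split.
    by apply: ge_ereal_sup => _ [Z /Asub VEZ <-]; exact: DX_le_max.
  apply/lee_subgt0Pr => e e0.
  have [Z /subA AZ leZ] := Xsup2_approx V E X e VEX e0.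
  by apply: (le_trans leZ); apply: ereal_sup_ubound; exists Z.
(* Approximation is a hypothesis here because the approximants depend on whether F is finite. *)
have infE A : (forall Z, A Z -> Xinf V F Z) ->
    (forall e, 0 < e -> exists2 Z, A Z &
      (DX Z <= (Num.min (2 * V) (EVF V F) + e)%:E)%E) ->
    ereal_inf (DX_image A) = (Num.min (2 * V) (EVF V F))%:E.
  move=> Asub approx; apply/eqP; rewrite eq_le; apply/andP; split; last first.
    by apply: le_ereal_inf_tmp => _ [Z /Asub VFZ <-]; exact: min_le_DX.
  apply/lee_addgt0Pr => e /approx[Z AZ]; apply: le_trans.
  by apply: ereal_inf_lbound; exists Z.
split.
- by apply: supE => // Z [].
- move=> [X VFX]; apply: infE => // e e0.
  case: F hF VFX => [F| |]// _ VFX.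
    by have [Z [VFZ _] leZ] := Xinf2_approx V F X e VFX e0; exists Z.
  have [Z VFZ leZ] := Xinf_approx_pinfty V X e VFX e0; exists Z => //.
  (* For infinite F the minimum is V, because V >= 0 gives V <= 2V. *)
  rewrite (le_trans leZ)// lee_fin lerD2r le_min lexx andbT.
  have [_ XV _] := VFX; have : 0 <= V by rewrite -lee_fin -XV variance_ge0.
  by lra.
- by apply: supE => // Z [].
- move=> [X [VFX X2]]; apply: infE => [Z []//|e e0].
  case: F hF VFX => [F| |]// _ VFX; first exact: Xinf2_approx VFX e0.
  (* A two-valued variable is bounded, so F_X is finite and this case is void. *)
  have [Xp _ XF] := VFX; have [a [b Xab]] := X2.
  have : (MX X <= (Num.max a b)%:E)%E.
    apply: MX_le; apply: aeW => w.
    by have [] := Xab (rv_fun X w) (ex_intro2 _ _ w I erefl) => ->;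
      rewrite le_max lexx ?orbT.
  case MXE : (MX X) (MX_ge0 X Xp) => [M| |]// _ _.
  by move: XF; rewrite (FXE X M Xp MXE).
Qed.
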